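(* Let $Q$ be the unique positive, decaying solution, smooth on $[0,\infty)$, of $-y''(r)-\frac{2}{r}y'(r)+y(r)-y^3(r)=0$, and let $$L_-=-\frac{d^2}{dr^2}-\frac{2}{r}\frac{d}{dr}+1-Q^2(r)$$ on $(0,\infty)$. Then $L_-$ has no ($L^2(\mathbb{R}^+)$) eigenvalue or resonance $\lambda$ in the interval $(0,1]$.
   Context: $Q$ is the ground state of the cubic radial equation $-y''-\frac2r y'+y-y^3=0$ in three dimensions; by a theorem of Coffman there is a unique positive decaying solution that is smooth on $[0,\infty)$. Meaning of ''eigenvalue or resonance'': $\lambda\in(0,1]$ is an eigenvalue or resonance of $L_-$ if there is a not identically zero solution $y$ of $L_-y=\lambda y$ on $(0,\infty)$ which is bounded near $r=0$ and satisfies $y(r)=O\big(r^{-1}e^{-r\sqrt{1-\lambda}}\big)$ as $r\to\infty$ (for $\lambda<1$ this is the same as $y$ being bounded near $0$ and square integrable at infinity; for $\lambda=1$ it says that $y$ decays like $1/r$). Equivalently, with $y_1$ the solution of $L_-y=\lambda y$ with $y_1(0;\lambda)=1$ and $y_2$ the solution with $y_2(r;\lambda)=r^{-1}e^{-r\sqrt{1-\lambda}}(1+o(1))$ as $r\to\infty$, the Wronskian $y_1y_2'-y_2y_1'$ vanishes. *)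

(* Defs.v *)
From Stdlib Require Import Reals.
From Coquelicot Require Import Coquelicot.
Open Scope R_scope.

(* Derivative at a point of [0, oo) of a function on [0, oo): the increments
   are restricted to r + h >= 0, so this is two-sided for r > 0 and
   right-sided at r = 0. *)
Definition is_derive_half_line (f : R -> R) (r l : R) : Prop :=
  filterlim (fun h => (f (r + h) - f r) / h)
    (within (fun h => 0 <= r + h) (locally' 0)) (locally l).

(* [D n] is the n-th derivative of [f] on [0, oo); values at negative
   arguments play no role. *)
Definition smooth_half_line (f : R -> R) : Prop :=
  exists D : nat -> R -> R,
    (forall r, 0 <= r -> D 0%nat r = f r) /\
    (forall n r, 0 <= r -> is_derive_half_line (D n) r (D (S n) r)).

Definition ground_state (Q : R -> R) : Prop :=
  smooth_half_line Q /\
  (forall r, 0 <= r -> 0 < Q r) /\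
  is_lim Q p_infty 0 /\
  (forall r, 0 < r ->
     - Derive_n Q 2 r - 2 / r * Derive Q r + Q r - Q r ^ 3 = 0).

Definition Lminus (Q y : R -> R) (r : R) : R :=
  - Derive_n y 2 r - 2 / r * Derive y r + (1 - Q r ^ 2) * y r.

(* [Derive] is a total operator, hence the explicit differentiability. *)
Definition twice_derivable_pos (y : R -> R) : Prop :=
  forall r, 0 < r -> ex_derive y r /\ ex_derive (Derive y) r.

(* For lambda = 1 the decay condition reads y = O(1/r) (a resonance); for
   0 < lambda < 1 it amounts to square integrability at infinity. *)
Definition eigenvalue_or_resonance (Q : R -> R) (lambda : R) : Prop :=
  exists y : R -> R,
    twice_derivable_pos y /\
    (forall r, 0 < r -> Lminus Q y r = lambda * y r) /\
    (exists r, 0 < r /\ y r <> 0) /\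
    (exists M, at_right 0 (fun r => Rabs (y r) <= M)) /\
    (exists C, Rbar_locally p_infty (fun r =>
       Rabs (y r) <= C * (/ r * exp (- r * sqrt (1 - lambda))))).

(* Main.v *)
Require Import Defs.
From Stdlib Require Import Reals.
From Coquelicot Require Import Coquelicot.
From Stdlib Require Import Lra Psatz Ranalysis5.
Open Scope R_scope.

(** Put u = r Q and v = r y. Then u'' = (1 - Q^2) u with u > 0, and a radial
    solution of L_- y = lambda y becomes v'' = (1 - lambda - Q^2) v, where v
    vanishes at 0, has a bounded derivative near 0 and stays bounded at
    infinity. The theorem says that v = 0, and it follows from Sturm theory:
    v can neither be free of zeros nor have one.

    A zero-free v is impossible because u is itself a positive solution for the
    smaller parameter 0; the Wronskian of u and v then drives v / u through
    zero ([solution_not_positive]).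

    A zero of v is excluded by positive supersolutions w, that is w > 0 and
    w'' <= (1 - lambda - Q^2) w. Such a w makes Picone's quantity
    v (w v' - w' v) / w nondecreasing, so v cannot vanish at, or be small
    towards, both ends of an interval carrying w unless v = 0
    ([picone_rigid]). Let p be the point where u has its maximum.

    On (0, p] take w = (1 - r^2 / 2) u ([inner_supersolution]). It is a
    supersolution because u' >= 0, and it is positive because p^2 < 2. The
    latter is [peak_radius_sq_lt2]: positivity of the energy
    E = u'^2 / 2 - u^2 / 2 + u^4 / (4 r^2) at p gives u(p)^2 > 2 p^2, while
    a comparison of the growth of (r u')^2 / 2 + u^4 / 4 on (0, p) gives
    u(p)^2 <= 2 + p^2.

    Beyond p take w = Phi = - u' / u, the decay rate of u
    ([decay_rate_supersolution]). A computation turns Phi'' <= - Q^2 Phi into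
    the statement that E / u decreases, and this follows from E > 0 and
    E -> 0 by one more monotonicity argument ([energy_slope_bound]). Since
    Phi stays between positive constants at infinity, a solution v with a zero
    beyond p would grow linearly, which the decay condition on y forbids
    even for lambda = 1.

    The facts about Q used on the way are that Q decreases
    ([profile_decreasing]) and that E > 0 ([energy_pos]). Both hold because
    the energies of Q and of u decrease and Q tends to 0. *)

(** * Monotonicity and sign changes *)

Lemma derive_nonneg_le (f g : R -> R) (a b : R) :
  a <= b ->
  (forall x, a <= x <= b -> is_derive f x (g x) /\ 0 <= g x) -> f a <= f b.
Proof.
intros Hab H.
destruct (MVT_gen f a b g) as [c [Hc Heq]].
- intros x Hx; rewrite Rmin_left, Rmax_right in Hx by lra; apply H; lra.
- intros x Hx; rewrite Rmin_left, Rmax_right in Hx by lra.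
  apply continuity_pt_filterlim, (ex_derive_continuous f).
  exists (g x); apply H; lra.
- rewrite Rmin_left, Rmax_right in Hc by lra.
  destruct (H c Hc) as [_ Hg]; nra.
Qed.

Lemma derive_pos_lt (f g : R -> R) (a b : R) :
  a < b ->
  (forall x, a <= x <= b -> is_derive f x (g x) /\ 0 < g x) -> f a < f b.
Proof.
intros Hab H.
destruct (MVT_gen f a b g) as [c [Hc Heq]].
- intros x Hx; rewrite Rmin_left, Rmax_right in Hx by lra; apply H; lra.
- intros x Hx; rewrite Rmin_left, Rmax_right in Hx by lra.
  apply continuity_pt_filterlim, (ex_derive_continuous f).
  exists (g x); apply H; lra.
- rewrite Rmin_left, Rmax_right in Hc by lra.
  destruct (H c Hc) as [_ Hg]; nra.
Qed.

Lemma is_derive_opp_val (f : R -> R) (x l : R) :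
  is_derive f x l -> is_derive (fun y => - f y) x (- l).
Proof. exact (is_derive_opp f x l). Qed.

Lemma derive_nonpos_ge (f g : R -> R) (a b : R) :
  a <= b ->
  (forall x, a <= x <= b -> is_derive f x (g x) /\ g x <= 0) -> f b <= f a.
Proof.
intros Hab H.
cut (- f a <= - f b); [lra|].
apply (derive_nonneg_le (fun x => - f x) (fun x => - g x)); [exact Hab|].
intros x Hx; destruct (H x Hx) as [H1 H2]; split; [|lra].
now apply is_derive_opp_val.
Qed.

Lemma derive_neg_gt (f g : R -> R) (a b : R) :
  a < b ->
  (forall x, a <= x <= b -> is_derive f x (g x) /\ g x < 0) -> f b < f a.
Proof.
intros Hab H.
cut (- f a < - f b); [lra|].
apply (derive_pos_lt (fun x => - f x) (fun x => - g x)); [exact Hab|].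
intros x Hx; destruct (H x Hx) as [H1 H2]; split; [|lra].
now apply is_derive_opp_val.
Qed.

(** Stands in for the mean value inequality on [0, a] when nothing is known at
    the endpoint 0 itself, only that f is small near it: the quantities
    monitored below are differentiable on (0, oo) only. *)
Lemma nonpos_from_zero (f g : R -> R) (K d a : R) :
  0 < d -> 0 < a ->
  (forall x, 0 < x <= a -> is_derive f x (g x) /\ g x <= 0) ->
  (forall x, 0 < x < d -> f x <= K * x) ->
  f a <= 0.
Proof.
intros Hd Ha H HK.
destruct (Rle_lt_dec (f a) 0) as [|Hfa]; [assumption|exfalso].
set (s := Rmin (Rmin a (d / 2)) (f a / (2 * (Rabs K + 1)))).
pose proof (Rabs_pos K) as HKp.
assert (Hq : 0 < f a / (2 * (Rabs K + 1))) by (apply Rdiv_lt_0_compat; lra).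
assert (Hs : 0 < s <= a /\ s < d /\ s <= f a / (2 * (Rabs K + 1))).
{ unfold s; repeat split.
  - repeat apply Rmin_pos; lra.
  - eapply Rle_trans; [apply Rmin_l|apply Rmin_l].
  - eapply Rle_lt_trans; [apply Rmin_l|].
    eapply Rle_lt_trans; [apply Rmin_r|]; lra.
  - apply Rmin_r. }
destruct Hs as [[Hs0 Hsa] [Hsd HsK]].
assert (H1 : f a <= f s).
{ apply (derive_nonpos_ge f g); [lra|]; intros x Hx; apply H; lra. }
assert (H2 := HK s ltac:(lra)).
assert (H3 : s * (2 * (Rabs K + 1)) <= f a).
{ apply Rmult_le_compat_r with (r := 2 * (Rabs K + 1)) in HsK; [|lra].
  replace (f a / (2 * (Rabs K + 1)) * (2 * (Rabs K + 1))) with (f a) in HsK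
    by (field; lra).
  exact HsK. }
pose proof (Rle_abs K); nra.
Qed.

Lemma neg_from_zero (f g : R -> R) (K d a : R) :
  0 < d -> 0 < a ->
  (forall x, 0 < x <= a -> is_derive f x (g x) /\ g x < 0) ->
  (forall x, 0 < x < d -> f x <= K * x) ->
  f a < 0.
Proof.
intros Hd Ha H HK.
apply Rlt_le_trans with (f (a / 2)).
- apply (derive_neg_gt f g); [lra|]; intros x Hx; apply H; lra.
- apply (nonpos_from_zero f g K d); [lra|lra| |exact HK].
  intros x Hx; destruct (H x ltac:(lra)); split; [assumption|lra].
Qed.

Lemma is_derive_continuity_pt (f : R -> R) (x l : R) :
  is_derive f x l -> continuity_pt f x.
Proof.
intros H; apply continuity_pt_filterlim, (ex_derive_continuous f).
now exists l.
Qed.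

Lemma locally_Rlt (f : R -> R) (x c : R) :
  continuity_pt f x -> f x < c ->
  exists e, 0 < e /\ forall y, Rabs (y - x) < e -> f y < c.
Proof.
intros Hc Hlt.
apply continuity_pt_filterlim in Hc.
assert (HL : locally (f x) (fun z => z < c)) by (apply (open_lt c); exact Hlt).
destruct (Hc _ HL) as [e He].
exists e; split; [apply cond_pos|]; intros y Hy; apply (He y), Hy.
Qed.

(** A function that crosses zero only downwards cannot climb back: at the
    first zero after a its derivative would have to be nonnegative. *)
Lemma stays_negative (g g' : R -> R) (a b : R) :
  0 < a < b ->
  (forall x, 0 < x -> is_derive g x (g' x)) ->
  (forall x, 0 < x -> g x = 0 -> g' x < 0) ->
  g a < 0 -> g b < 0.
Proof.
intros Hab Hd Hz Hga.
destruct (Rlt_le_dec (g b) 0) as [|Hgb]; [assumption|exfalso].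
set (E := fun x => a <= x <= b /\ forall y, a <= y <= x -> g y < 0).
destruct (completeness E) as [s [Hub Hlub]].
- exists b; intros x [Hx _]; lra.
- exists a; split; [lra|]; intros y Hy; now replace y with a by lra.
- assert (Has : a <= s).
  { apply Hub; split; [lra|]; intros y Hy; now replace y with a by lra. }
  assert (Hsb : s <= b) by (apply Hlub; intros x [Hx _]; lra).
  assert (Hbelow : forall y, a <= y < s -> g y < 0).
  { intros y Hy.
    destruct (Rlt_le_dec (g y) 0) as [|Hgy]; [assumption|exfalso].
    cut (s <= y); [lra|].
    apply Hlub; intros x [Hx1 Hx2].
    destruct (Rle_lt_dec x y) as [|Hxy]; [assumption|].
    specialize (Hx2 y ltac:(lra)); lra. }
  assert (Hcs := is_derive_continuity_pt g s (g' s) (Hd s ltac:(lra))).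
  destruct (Rtotal_order (g s) 0) as [Hs|[Hs|Hs]].
  + destruct (locally_Rlt g s 0 Hcs Hs) as [e [He Hle]].
    destruct (Req_dec s b) as [->|Hne]; [lra|].
    set (t := Rmin b (s + e / 2)).
    assert (Ht : s < t <= b /\ t <= s + e / 2).
    { unfold t; repeat split; [apply Rmin_glb_lt; lra|apply Rmin_l|apply Rmin_r]. }
    cut (t <= s); [lra|].
    apply Hub; split; [lra|]; intros y Hy.
    destruct (Rlt_le_dec y s) as [Hys|Hys]; [apply Hbelow; lra|].
    apply Hle, Rabs_def1; lra.
  + specialize (Hz s ltac:(lra) Hs).
    destruct (Req_dec s a) as [->|Hne]; [lra|].
    assert (Hd' := Hd s ltac:(lra)).
    apply is_derive_Reals in Hd'.
    destruct (Hd' (- g' s / 2) ltac:(lra)) as [[e He] Hle]; simpl in Hle.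
    set (h := Rmin (e / 2) ((s - a) / 2)).
    assert (Hh : 0 < h /\ h <= e / 2 /\ h <= (s - a) / 2).
    { unfold h; repeat split; [apply Rmin_pos; lra|apply Rmin_l|apply Rmin_r]. }
    specialize (Hle (- h) ltac:(lra)).
    rewrite Rabs_Ropp, Rabs_pos_eq in Hle by lra.
    specialize (Hle ltac:(lra)).
    apply Rabs_def2 in Hle.
    specialize (Hbelow (s + - h) ltac:(lra)).
    rewrite Hs in Hle.
    assert (0 < (g (s + - h) - 0) / - h).
    { replace ((g (s + - h) - 0) / - h) with (- g (s + - h) / h) by (field; lra).
      apply Rdiv_lt_0_compat; lra. }
    lra.
  + assert (Hco : continuity_pt (fun y => - g y) s) by now apply continuity_pt_opp.
    destruct (locally_Rlt (fun y => - g y) s 0 Hco ltac:(lra)) as [e [He Hle]].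
    destruct (Req_dec s a) as [->|Hne]; [lra|].
    set (h := Rmin (e / 2) (s - a)).
    assert (Hh : 0 < h /\ h <= e / 2 /\ h <= s - a).
    { unfold h; repeat split; [apply Rmin_pos; lra|apply Rmin_l|apply Rmin_r]. }
    specialize (Hbelow (s - h) ltac:(lra)).
    specialize (Hle (s - h)).
    assert (Rabs (s - h - s) < e) by (apply Rabs_def1; lra).
    specialize (Hle H); lra.
Qed.

(** * The profile Q *)

(** Replaces a derivative left over by [auto_derive] by its value. *)
Ltac derive_val H :=
  match type of H with
  | is_derive ?f ?x ?l =>
      let E := fresh in
      assert (E : Derive (fun y => f y) x = l) by exact (is_derive_unique f x l H);
      rewrite ?E; clear E
  end.

(** The working form of a ground state Q with derivative Q1. The last clause
    records the regularity at the centre of symmetry, where q = Q(0) and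
    Q'(0) = 0. *)
Definition radial_profile (Q Q1 : R -> R) : Prop :=
  (forall r, 0 < r -> 0 < Q r) /\
  (forall r, 0 < r -> is_derive Q r (Q1 r)) /\
  (forall r, 0 < r -> is_derive Q1 r (Q r - Q r ^ 3 - 2 / r * Q1 r)) /\
  (forall c, 0 < c -> exists R0, 0 < R0 /\ forall r, R0 <= r -> Q r < c) /\
  exists q K d, 0 < q /\ 0 < K /\ 0 < d /\
    forall r, 0 < r < d -> Rabs (Q r - q) <= K * r /\ Rabs (Q1 r) <= K * r.

Lemma half_line_derive_pos (f : R -> R) (r l : R) :
  0 < r -> is_derive_half_line f r l -> is_derive f r l.
Proof.
intros Hr H; apply is_derive_Reals; intros eps Heps.
destruct (H (ball l (mkposreal eps Heps)) (locally_ball _ _)) as [e He].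
assert (Hm : 0 < Rmin e r) by (apply Rmin_pos; [apply cond_pos|lra]).
exists (mkposreal _ Hm); simpl; intros h Hh Hlt.
apply He; [|exact Hh|].
- unfold ball; simpl; unfold AbsRing_ball, abs, minus, plus, opp; simpl.
  rewrite Ropp_0, Rplus_0_r.
  eapply Rlt_le_trans; [exact Hlt|apply Rmin_l].
- assert (Rabs h < r) by (eapply Rlt_le_trans; [exact Hlt|apply Rmin_r]).
  destruct (Rabs_def2 _ _ H0); lra.
Qed.

Lemma half_line_derive_zero (f : R -> R) (l : R) :
  is_derive_half_line f 0 l ->
  exists d, 0 < d /\
    forall h, 0 < h < d -> Rabs (f h - f 0) <= (Rabs l + 1) * h.
Proof.
intros H.
destruct (H (ball l (mkposreal 1 Rlt_0_1)) (locally_ball _ _)) as [e He].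
exists e; split; [apply cond_pos|]; intros h Hh.
assert (Hb : ball l 1 ((f (0 + h) - f 0) / h)).
{ apply He; [|lra|lra].
  unfold ball; simpl; unfold AbsRing_ball, abs, minus, plus, opp; simpl.
  rewrite Ropp_0, Rplus_0_r, Rabs_pos_eq; lra. }
rewrite Rplus_0_l in Hb.
unfold ball in Hb; simpl in Hb;
  unfold AbsRing_ball, abs, minus, plus, opp in Hb; simpl in Hb.
replace (f h - f 0) with (((f h - f 0) / h + - l + l) * h) by (field; lra).
rewrite Rabs_mult, (Rabs_pos_eq h) by lra.
apply Rmult_le_compat_r; [lra|].
eapply Rle_trans; [apply Rabs_triang|lra].
Qed.

Lemma ground_state_profile (Q : R -> R) :
  ground_state Q -> radial_profile Q (Derive Q).
Proof.
intros [[D [HD0 HD]] [Hpos [Hlim Hode]]].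
assert (Hloc : forall r, 0 < r -> locally r (fun x => D 0%nat x = Q x)).
{ intros r Hr; exists (mkposreal r Hr); intros x Hx.
  apply HD0.
  unfold ball in Hx; simpl in Hx;
  unfold AbsRing_ball, abs, minus, plus, opp in Hx; simpl in Hx.
  destruct (Rabs_def2 _ _ Hx); lra. }
assert (HQ1 : forall r, 0 < r -> is_derive Q r (D 1%nat r)).
{ intros r Hr; apply is_derive_ext_loc with (D 0%nat); [now apply Hloc|].
  apply half_line_derive_pos; [lra|apply HD; lra]. }
assert (HD1 : forall r, 0 < r -> Derive Q r = D 1%nat r).
{ intros r Hr; now apply is_derive_unique, HQ1. }
assert (HQ2 : forall r, 0 < r -> is_derive (Derive Q) r (D 2%nat r)).
{ intros r Hr; apply is_derive_ext_loc with (D 1%nat).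
  - exists (mkposreal r Hr); intros x Hx; symmetry; apply HD1.
    unfold ball in Hx; simpl in Hx;
    unfold AbsRing_ball, abs, minus, plus, opp in Hx; simpl in Hx.
    destruct (Rabs_def2 _ _ Hx); lra.
  - apply half_line_derive_pos; [lra|apply HD; lra]. }
assert (HD2 : forall r, 0 < r ->
  D 2%nat r = Q r - Q r ^ 3 - 2 / r * Derive Q r).
{ intros r Hr; generalize (Hode r Hr).
  change (Derive_n Q 2 r) with (Derive (Derive Q) r).
  rewrite (is_derive_unique _ _ _ (HQ2 r Hr)); lra. }
split; [|split; [|split; [|split]]].
- intros r Hr; apply Hpos; lra.
- intros r Hr; rewrite HD1 by assumption; now apply HQ1.
- intros r Hr; rewrite <- HD2 by assumption; now apply HQ2.
- intros c Hc.
  apply is_lim_spec in Hlim; destruct (Hlim (mkposreal c Hc)) as [M HM].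
  exists (Rmax M 0 + 1); split; [pose proof (Rmax_r M 0); lra|].
  intros r Hr; pose proof (Rmax_l M 0).
  specialize (HM r ltac:(lra)); simpl in HM; rewrite Rminus_0_r in HM.
  now destruct (Rabs_def2 _ _ HM).
- destruct (half_line_derive_zero _ _ (HD 0%nat 0 (Rle_refl 0)))
    as [d0 [Hd0 H0]].
  destruct (half_line_derive_zero _ _ (HD 2%nat 0 (Rle_refl 0)))
    as [d2 [Hd2 H2]].
  set (K0 := Rabs (D 1%nat 0) + 1) in *.
  set (K2 := Rabs (D 3%nat 0) + 1) in *.
  assert (HK0 : 0 < K0) by (unfold K0; pose proof (Rabs_pos (D 1%nat 0)); lra).
  assert (HK2 : 0 < K2) by (unfold K2; pose proof (Rabs_pos (D 3%nat 0)); lra).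
  rewrite HD0 in H0 by lra.
  assert (Hq := Hpos 0 (Rle_refl 0)); set (q := Q 0) in *.
  set (B := q + K0).
  set (K1 := B + B ^ 3 + Rabs (D 2%nat 0) + K2).
  assert (HB : 0 < B) by (unfold B; lra).
  assert (HB3 : 0 < B ^ 3) by now apply pow_lt.
  assert (HK1 : 0 < K1)
    by (unfold K1; pose proof (Rabs_pos (D 2%nat 0)); lra).
  exists q, (K0 + K1), (Rmin 1 (Rmin d0 d2)).
  split; [exact Hq|]; split; [lra|]; split; [repeat apply Rmin_pos; lra|].
  intros r [Hr0 Hr].
  assert (Hr1 : r < 1 /\ r < d0 /\ r < d2).
  { pose proof (Rmin_l 1 (Rmin d0 d2)); pose proof (Rmin_r 1 (Rmin d0 d2)).
    pose proof (Rmin_l d0 d2); pose proof (Rmin_r d0 d2); lra. }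
  specialize (H0 r ltac:(lra)); specialize (H2 r ltac:(lra)).
  rewrite HD0 in H0 by lra.
  split; [nra|].
  assert (HQB : 0 < Q r <= B).
  { split; [apply Hpos; lra|]; unfold B.
    pose proof (Rle_abs (Q r - q)); nra. }
  assert (HQ3 : 0 < Q r ^ 3 <= B ^ 3).
  { split; [now apply pow_lt|apply pow_incr; lra]. }
  (* The singular coefficient 2/r bounds Q' by r: the other terms of the
     equation are bounded near the origin. *)
  assert (Heq : Derive Q r = r / 2 * (Q r - Q r ^ 3 - D 2%nat r)).
  { rewrite HD2 by lra; field; lra. }
  rewrite Heq, Rabs_mult, (Rabs_pos_eq (r / 2)) by lra.
  assert (Rabs (D 2%nat r) <= Rabs (D 2%nat 0) + K2).
  { replace (D 2%nat r) with (D 2%nat 0 + (D 2%nat r - D 2%nat 0)) by ring.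
    eapply Rle_trans; [apply Rabs_triang|]; nra. }
  assert (Rabs (Q r - Q r ^ 3 - D 2%nat r) <= K1).
  { unfold K1.
    apply Rabs_le; pose proof (Rle_abs (D 2%nat r));
    pose proof (Rle_abs (- D 2%nat r)) as Ha; rewrite Rabs_Ropp in Ha; lra. }
  nra.
Qed.

(** The mechanical energy of Q is dissipated by the friction term 2Q'/r and
    its kinetic part is nonnegative. If it were negative somewhere, Q would
    stay away from 0 from there on. *)
Lemma profile_energy_nonneg (Q Q1 : R -> R) (r : R) :
  radial_profile Q Q1 -> 0 < r ->
  0 <= Q1 r ^ 2 / 2 - Q r ^ 2 / 2 + Q r ^ 4 / 4.
Proof.
intros (Hpos & HQ & HQ1 & Hlim & _) Hr.
set (E := fun r => Q1 r ^ 2 / 2 - Q r ^ 2 / 2 + Q r ^ 4 / 4).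
change (0 <= E r).
destruct (Rle_lt_dec 0 (E r)) as [|HE]; [assumption|exfalso].
set (c := Rmin 1 (- E r)).
assert (Hc : 0 < c <= 1 /\ c <= - E r).
{ unfold c; repeat split; [apply Rmin_pos; lra|apply Rmin_l|apply Rmin_r]. }
destruct (Hlim c ltac:(lra)) as [R0 [HR0 HR]].
set (s := Rmax r R0).
assert (Hs : r <= s /\ R0 <= s) by (split; [apply Rmax_l|apply Rmax_r]).
assert (HEs : E s <= E r).
{ apply (derive_nonpos_ge E (fun x => - 2 / x * Q1 x ^ 2)); [lra|].
  intros x Hx; split.
  - unfold E; auto_derive.
    + repeat split; eexists; [apply HQ1|apply HQ|apply HQ]; lra.
    + derive_val (HQ x ltac:(lra)).
      derive_val (HQ1 x ltac:(lra)); field; lra.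
  - replace (- 2 / x * Q1 x ^ 2) with (- (2 * / x * Q1 x ^ 2)) by (field; lra).
    assert (0 < / x) by (apply Rinv_0_lt_compat; lra).
    pose proof (pow2_ge_0 (Q1 x)); nra. }
specialize (HR s ltac:(lra)); specialize (Hpos s ltac:(lra)).
unfold E in HEs at 1; pose proof (pow2_ge_0 (Q1 s)).
assert (0 < Q s ^ 4) by now apply pow_lt.
nra.
Qed.

(** At the origin the kinetic energy vanishes, so nonnegative energy forces
    Q(0)^2 >= 2. *)
Lemma profile_gt1_near_zero (Q Q1 : R -> R) :
  radial_profile Q Q1 -> exists d, 0 < d /\ forall r, 0 < r < d -> 1 < Q r.
Proof.
intros HP; pose proof HP as (Hpos & HQ & HQ1 & Hlim & q & K & d & Hq & HK & Hd & H0).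
destruct (Rle_lt_dec q 1) as [Hq1|Hq1].
- exfalso.
  set (r := Rmin (d / 2) (q / (5 * K))).
  assert (0 < q / (5 * K)) by (apply Rdiv_lt_0_compat; lra).
  assert (Hr : 0 < r /\ r <= d / 2 /\ r <= q / (5 * K)).
  { unfold r; repeat split; [apply Rmin_pos; lra|apply Rmin_l|apply Rmin_r]. }
  assert (HKr : K * r <= q / 5).
  { replace (q / 5) with (K * (q / (5 * K))) by (field; lra); nra. }
  destruct (H0 r ltac:(lra)) as [Ha Hb].
  apply Rabs_le_between in Ha; apply Rabs_le_between in Hb.
  assert (HE := profile_energy_nonneg Q Q1 r HP ltac:(lra)).
  assert (Q1 r ^ 2 <= (q / 5) ^ 2) by nra.
  assert ((4 / 5 * q) ^ 2 <= Q r ^ 2 <= (6 / 5) ^ 2) by nra.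
  assert (Q r ^ 4 = Q r ^ 2 * Q r ^ 2) by ring.
  nra.
- set (e := (q - 1) / K).
  assert (He : 0 < e) by (apply Rdiv_lt_0_compat; lra).
  exists (Rmin d e); split; [now apply Rmin_pos|]; intros r [Hr1 Hr2].
  pose proof (Rmin_l d e); pose proof (Rmin_r d e).
  destruct (H0 r ltac:(lra)) as [Ha _]; apply Rabs_le_between in Ha.
  assert (K * e = q - 1) by (unfold e; field; lra); nra.
Qed.

(** Where Q' = 0, nonnegative energy gives Q^2 >= 2 and then
    Q'' = Q - Q^3 < 0, so Q' crosses zero only downwards. It starts negative
    because (r^2 Q')' = r^2 (Q - Q^3) < 0 near the origin. *)
Lemma profile_decreasing (Q Q1 : R -> R) (r : R) :
  radial_profile Q Q1 -> 0 < r -> Q1 r < 0.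
Proof.
intros HP Hr; pose proof HP as (Hpos & HQ & HQ1 & Hlim & q & K & d & Hq & HK & Hd & H0).
destruct (profile_gt1_near_zero Q Q1 HP) as [e [He Hgt]].
set (a := Rmin (r / 2) (e / 2)).
assert (Ha : 0 < a /\ a <= r / 2 /\ a <= e / 2).
{ unfold a; repeat split; [apply Rmin_pos; lra|apply Rmin_l|apply Rmin_r]. }
apply (stays_negative Q1 (fun r => Q r - Q r ^ 3 - 2 / r * Q1 r) a r);
  [lra|exact HQ1| |].
- intros x Hx Hz.
  assert (HE := profile_energy_nonneg Q Q1 x HP Hx).
  rewrite Hz in *; specialize (Hpos x Hx).
  assert (H2 : 2 <= Q x ^ 2).
  { apply Rmult_le_reg_l with (Q x ^ 2); [now apply pow_lt|]; nra. }
  assert (1 < Q x) by nra. nra.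
- assert (Hg : a ^ 2 * Q1 a < 0).
  { apply (neg_from_zero (fun x => x ^ 2 * Q1 x)
      (fun x => x ^ 2 * (Q x - Q x ^ 3)) K (Rmin d 1) a);
      [apply Rmin_pos; lra|lra| |].
    - intros x Hx; split.
      + auto_derive; [repeat split; eexists; apply HQ1; lra|].
        derive_val (HQ1 x ltac:(lra)); field; lra.
      + specialize (Hgt x ltac:(lra)).
        assert (0 < x ^ 2) by (apply pow_lt; lra).
        assert (Q x - Q x ^ 3 < 0) by nra. nra.
    - intros x [Hx1 Hx2]; pose proof (Rmin_l d 1); pose proof (Rmin_r d 1).
      destruct (H0 x ltac:(lra)) as [_ Hb]; apply Rabs_le_between in Hb.
      assert (0 < x ^ 2 <= 1) by nra. nra. }
  assert (0 < a ^ 2) by (apply pow_lt; lra). nra.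
Qed.

Lemma profile_lt (Q Q1 : R -> R) (r s : R) :
  radial_profile Q Q1 -> 0 < r < s -> Q s < Q r.
Proof.
intros HP Hrs; apply (derive_neg_gt Q Q1); [lra|].
intros x Hx; split; [apply HP; lra|].
apply (profile_decreasing Q Q1 x HP); lra.
Qed.

Lemma profile_bounded (Q Q1 : R -> R) :
  radial_profile Q Q1 -> exists B, 0 < B /\ forall r, 0 < r -> Q r <= B.
Proof.
intros HP; pose proof HP as (Hpos & _ & _ & _ & q & K & d & Hq & HK & Hd & H0).
exists (q + K * d); split; [nra|]; intros r Hr.
destruct (Rlt_le_dec r d) as [Hrd|Hrd].
- destruct (H0 r ltac:(lra)) as [Ha _]; apply Rabs_le_between in Ha; nra.
- assert (Hlt := profile_lt Q Q1 (d / 2) r HP ltac:(lra)).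
  destruct (H0 (d / 2) ltac:(lra)) as [Ha _]; apply Rabs_le_between in Ha; nra.
Qed.

(** * The function u = r Q and its maximum *)

(** The substitution u = r Q removes the first-order term: u'' = (1 - Q^2) u.
    Below, [amp Q] is u and [slope Q Q1] is u'. *)
Definition amp (Q : R -> R) (r : R) : R := r * Q r.
Definition slope (Q Q1 : R -> R) (r : R) : R := Q r + r * Q1 r.

Lemma amp_pos (Q Q1 : R -> R) (r : R) :
  radial_profile Q Q1 -> 0 < r -> 0 < amp Q r.
Proof. intros HP Hr; apply Rmult_lt_0_compat; [lra|now apply HP]. Qed.

Lemma is_derive_amp (Q Q1 : R -> R) (r : R) :
  radial_profile Q Q1 -> 0 < r -> is_derive (amp Q) r (slope Q Q1 r).
Proof.
intros (_ & HQ & _) Hr; unfold amp, slope; auto_derive.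
- eexists; now apply HQ.
- derive_val (HQ r Hr); ring.
Qed.

Lemma is_derive_slope (Q Q1 : R -> R) (r : R) :
  radial_profile Q Q1 -> 0 < r ->
  is_derive (slope Q Q1) r ((1 - Q r ^ 2) * amp Q r).
Proof.
intros (_ & HQ & HQ1 & _) Hr; unfold amp, slope; auto_derive.
- repeat split; eexists; [now apply HQ|now apply HQ1].
- derive_val (HQ r Hr); derive_val (HQ1 r Hr); field; lra.
Qed.

(** Once Q <= 1, the function u is convex. A nonnegative slope there would make
    u grow linearly and keep Q = u / r away from 0. *)
Lemma slope_neg_of_profile_le1 (Q Q1 : R -> R) (b : R) :
  radial_profile Q Q1 -> 0 < b -> Q b <= 1 -> slope Q Q1 b < 0.
Proof.
intros HP Hb HQb.
destruct (Rlt_le_dec (slope Q Q1 b) 0) as [|Hs]; [assumption|exfalso].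
assert (Hconv : forall x, b < x -> 0 < (1 - Q x ^ 2) * amp Q x).
{ intros x Hx; assert (HA := amp_pos Q Q1 x HP ltac:(lra)).
  assert (HL := profile_lt Q Q1 b x HP ltac:(lra)).
  assert (0 < Q x) by (apply HP; lra).
  apply Rmult_lt_0_compat; nra. }
assert (Hincr : forall x y, b < x < y -> slope Q Q1 x < slope Q Q1 y).
{ intros x y Hxy.
  apply (derive_pos_lt _ (fun r => (1 - Q r ^ 2) * amp Q r)); [lra|].
  intros z Hz; split; [apply is_derive_slope; [exact HP|lra]|apply Hconv; lra]. }
set (c := slope Q Q1 (b + 1)).
assert (Hc : 0 < c).
{ apply Rle_lt_trans with (slope Q Q1 (b + 1 / 2)); [|apply Hincr; lra].
  eapply Rle_trans; [exact Hs|].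
  apply (derive_nonneg_le _ (fun r => (1 - Q r ^ 2) * amp Q r)); [lra|].
  intros z Hz; split; [apply is_derive_slope; [exact HP|lra]|].
  destruct (Req_dec z b) as [->|]; [|left; apply Hconv; lra].
  assert (HA := amp_pos Q Q1 b HP Hb); assert (0 < Q b) by now apply HP.
  apply Rmult_le_pos; nra. }
pose proof HP as (_ & _ & _ & Hlim & _).
destruct (Hlim (c / 2) ltac:(lra)) as [R0 [HR0 HR]].
set (s := Rmax R0 (2 * (b + 1))).
assert (Hs' : R0 <= s /\ 2 * (b + 1) <= s) by (split; [apply Rmax_l|apply Rmax_r]).
assert (Hg : amp Q (b + 1) - c * (b + 1) <= amp Q s - c * s).
{ apply (derive_nonneg_le (fun x => amp Q x - c * x)
          (fun x => slope Q Q1 x - c)); [lra|].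
  intros x Hx; assert (HA := is_derive_amp Q Q1 x HP ltac:(lra)); split.
  - auto_derive; [repeat split; eexists; apply HA|].
    derive_val HA; ring.
  - destruct (Req_dec x (b + 1)) as [->|]; [unfold c; lra|].
    specialize (Hincr (b + 1) x ltac:(lra)); unfold c; lra. }
assert (HA := amp_pos Q Q1 (b + 1) HP ltac:(lra)).
specialize (HR s ltac:(lra)).
assert (Hlow : c * s / 2 <= amp Q s) by nra.
unfold amp in Hlow; nra.
Qed.

(** The energy of u'' = u - u^3 / r^2; it is not conserved because the
    nonlinearity depends on r. *)
Definition energy (Q Q1 : R -> R) (r : R) : R :=
  slope Q Q1 r ^ 2 / 2 - amp Q r ^ 2 / 2 + amp Q r ^ 4 / (4 * r ^ 2).

Lemma is_derive_energy (Q Q1 : R -> R) (r : R) :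
  radial_profile Q Q1 -> 0 < r ->
  is_derive (energy Q Q1) r (- amp Q r ^ 4 / (2 * r ^ 3)).
Proof.
intros HP Hr; unfold energy.
assert (HA := is_derive_amp Q Q1 r HP Hr).
assert (HS := is_derive_slope Q Q1 r HP Hr).
auto_derive.
- repeat split; try (eexists; eassumption); nra.
- derive_val HA; derive_val HS.
  replace (Q r) with (amp Q r / r) by (unfold amp; field; lra).
  field; lra.
Qed.

Lemma energy_lt (Q Q1 : R -> R) (r s : R) :
  radial_profile Q Q1 -> 0 < r < s -> energy Q Q1 s < energy Q Q1 r.
Proof.
intros HP Hrs.
apply (derive_neg_gt _ (fun r => - amp Q r ^ 4 / (2 * r ^ 3))); [lra|].
intros x Hx; split; [apply is_derive_energy; [exact HP|lra]|].
assert (HA := amp_pos Q Q1 x HP ltac:(lra)).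
assert (0 < amp Q x ^ 4 / (2 * x ^ 3)).
{ apply Rdiv_lt_0_compat; [now apply pow_lt|].
  assert (0 < x ^ 3) by (apply pow_lt; lra); lra. }
unfold Rdiv in *; lra.
Qed.

Lemma energy_eq (Q Q1 : R -> R) (r : R) :
  0 < r ->
  energy Q Q1 r = slope Q Q1 r ^ 2 / 2 - amp Q r ^ 2 * (1 - Q r ^ 2 / 2) / 2.
Proof. intros Hr; unfold energy, amp; field; lra. Qed.

(** A negative energy would persist and bound u from below; then
    u'' = (1 - Q^2) u would also be bounded below once Q is small, making u'
    positive, against [slope_neg_of_profile_le1]. *)
Lemma energy_pos (Q Q1 : R -> R) (r : R) :
  radial_profile Q Q1 -> 0 < r -> 0 < energy Q Q1 r.
Proof.
intros HP.
cut (forall r, 0 < r -> 0 <= energy Q Q1 r).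
{ intros H Hr; apply Rle_lt_trans with (energy Q Q1 (r + 1)).
  - apply H; lra.
  - apply energy_lt; [exact HP|lra]. }
clear r; intros r Hr.
destruct (Rle_lt_dec 0 (energy Q Q1 r)) as [|HE]; [assumption|exfalso].
set (e := - energy Q Q1 r).
assert (He : 0 < e) by (unfold e; lra).
set (c := Rmin 1 e).
assert (Hc : 0 < c /\ c <= 1 /\ c <= e).
{ unfold c; repeat split; [apply Rmin_pos; lra|apply Rmin_l|apply Rmin_r]. }
pose proof HP as (Hpos & _ & _ & Hlim & _).
destruct (Hlim (1 / 2) ltac:(lra)) as [R0 [HR0 HR]].
set (R1 := Rmax r R0 + 1).
assert (HR1 : r < R1 /\ R0 <= R1).
{ unfold R1; pose proof (Rmax_l r R0); pose proof (Rmax_r r R0); lra. }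
assert (Hamp : forall x, R1 <= x -> c <= amp Q x).
{ intros x Hx.
  assert (HL := energy_lt Q Q1 r x HP ltac:(lra)).
  rewrite (energy_eq _ _ x) in HL by lra.
  assert (HA := amp_pos Q Q1 x HP ltac:(lra)).
  assert (HQ := HR x ltac:(lra)); assert (HQ' := Hpos x ltac:(lra)).
  fold e in HL.
  assert (0 < amp Q x ^ 2 * Q x ^ 2) by (apply Rmult_lt_0_compat; nra).
  assert (e <= amp Q x ^ 2) by (unfold e; nra).
  nra. }
(* Beyond R1 one has u'' >= c / 2, so u' has reached c / 2 at s. *)
set (s := R1 - 2 * slope Q Q1 R1 / c + 1).
assert (HsR : slope Q Q1 R1 < 0).
{ apply slope_neg_of_profile_le1; [exact HP|lra|].
  assert (HQ := HR R1 ltac:(lra)); lra. }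
assert (Hq : 0 < - slope Q Q1 R1 / c) by (apply Rdiv_lt_0_compat; lra).
assert (Hs : R1 < s).
{ unfold s; unfold Rdiv in *; lra. }
assert (Hss : slope Q Q1 s < 0).
{ apply slope_neg_of_profile_le1; [exact HP|lra|].
  assert (HQ := HR s ltac:(lra)); lra. }
assert (Hg : slope Q Q1 R1 - c / 2 * R1 <= slope Q Q1 s - c / 2 * s).
{ apply (derive_nonneg_le (fun x => slope Q Q1 x - c / 2 * x)
          (fun x => (1 - Q x ^ 2) * amp Q x - c / 2)); [lra|].
  intros x Hx; assert (HA := is_derive_slope Q Q1 x HP ltac:(lra)); split.
  - auto_derive; [repeat split; eexists; apply HA|].
    derive_val HA; ring.
  - specialize (Hamp x ltac:(lra)).
    assert (HQ := HR x ltac:(lra)); assert (HQ' := Hpos x ltac:(lra)).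
    assert (Q x ^ 2 <= 1 / 2) by nra. nra. }
assert (c / 2 * (s - R1) = - slope Q Q1 R1 + c / 2) by (unfold s; field; lra).
lra.
Qed.

Lemma amp_slope_near_zero (Q Q1 : R -> R) :
  radial_profile Q Q1 ->
  exists c K d, 0 < c /\ 0 < K /\ 0 < d <= 1 /\ forall r, 0 < r < d ->
    c * r <= amp Q r <= K * r /\ c <= slope Q Q1 r <= K.
Proof.
intros (_ & _ & _ & _ & q & K & d & Hq & HK & Hd & H0).
set (e := Rmin (Rmin 1 d) (q / (4 * K))).
assert (0 < q / (4 * K)) by (apply Rdiv_lt_0_compat; lra).
assert (He : 0 < e /\ e <= 1 /\ e <= d /\ e <= q / (4 * K)).
{ unfold e; repeat split.
  - repeat apply Rmin_pos; lra.
  - eapply Rle_trans; [apply Rmin_l|apply Rmin_l].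
  - eapply Rle_trans; [apply Rmin_l|apply Rmin_r].
  - apply Rmin_r. }
assert (HKe : K * e <= q / 4).
{ replace (q / 4) with (K * (q / (4 * K))) by (field; lra); nra. }
exists (q / 2), (2 * q), e; split; [lra|]; split; [lra|]; split; [lra|].
intros r Hr; destruct (H0 r ltac:(lra)) as [Ha Hb].
apply Rabs_le_between in Ha; apply Rabs_le_between in Hb.
unfold amp, slope.
assert (K * r <= q / 4) by nra.
assert (- (q / 4) <= r * Q1 r <= q / 4) by nra.
split; [split; nra|lra].
Qed.

(** Before its maximum at p, u satisfies r u' <= u because Q decreases, and
    r^2 <= u^2 / Q(p)^2 for the same reason. Hence
    (r u')^2 / 2 + u^4 / 4 grows at most as fast as
    u^2 / 2 + u^4 / (4 Q(p)^2), and comparing values at p gives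
    u(p)^2 <= 2 + p^2. The hypothesis on Q(p) says u(p)^2 > 2 p^2, so
    p^2 < 2. *)
Lemma peak_radius_sq_lt2 (Q Q1 : R -> R) (p : R) :
  radial_profile Q Q1 -> 0 < p -> slope Q Q1 p = 0 ->
  2 < Q p ^ 2 -> (forall r, 0 < r <= p -> 0 <= slope Q Q1 r) ->
  p ^ 2 < 2.
Proof.
intros HP Hp Hsp HQp Hs.
destruct (amp_slope_near_zero Q Q1 HP) as (c & K & d & Hc & HK & Hd & H0).
set (k := / Q p ^ 2).
assert (Hk : 0 < k) by (apply Rinv_0_lt_compat; lra).
assert (HkQ : k * Q p ^ 2 = 1) by (unfold k; field; pose proof (proj1 HP p Hp); lra).
set (F := fun r => (r * slope Q Q1 r) ^ 2 / 2 + amp Q r ^ 4 / 4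
  - amp Q r ^ 2 / 2 - k * amp Q r ^ 4 / 4).
assert (HF : F p <= 0).
{ apply (nonpos_from_zero F (fun r => slope Q Q1 r *
    (r ^ 2 * Q1 r + amp Q r * (r ^ 2 - k * amp Q r ^ 2)))
    (K ^ 2 / 2 + K ^ 4 / 4) d p); [lra|lra| |].
  - intros r Hr; split.
    + unfold F.
      assert (HA := is_derive_amp Q Q1 r HP ltac:(lra)).
      assert (HS := is_derive_slope Q Q1 r HP ltac:(lra)).
      auto_derive; [repeat split; eexists; eassumption|].
      derive_val HA; derive_val HS; unfold amp, slope; field.
    + assert (HQ1 := profile_decreasing Q Q1 r HP ltac:(lra)).
      specialize (Hs r ltac:(lra)).
      assert (HA := amp_pos Q Q1 r HP ltac:(lra)).
      assert (HQ : Q p <= Q r).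
      { destruct (Req_dec r p) as [->|]; [lra|].
        left; apply (profile_lt Q Q1); [exact HP|lra]. }
      assert (HQpp := proj1 HP p Hp).
      assert (Hr2 : 0 < r ^ 2) by (apply pow_lt; lra).
      assert (Hle : r ^ 2 - k * amp Q r ^ 2 <= 0).
      { replace (r ^ 2 - k * amp Q r ^ 2) with (r ^ 2 * (1 - k * Q r ^ 2))
          by (unfold amp; ring).
        assert (Q p ^ 2 <= Q r ^ 2) by (apply pow_incr; lra).
        assert (1 <= k * Q r ^ 2) by nra. nra. }
      assert (r ^ 2 * Q1 r <= 0) by nra.
      assert (amp Q r * (r ^ 2 - k * amp Q r ^ 2) <= 0) by nra.
      nra.
  - intros r Hr; destruct (H0 r Hr) as [[Ha1 Ha2] [Hs1 Hs2]]; unfold F.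
    assert (0 < c * r) by nra.
    assert (Hr2 : 0 < r ^ 2 <= r) by (split; [apply pow_lt; lra|nra]).
    assert (slope Q Q1 r ^ 2 <= K ^ 2) by (apply pow_incr; lra).
    assert (0 <= amp Q r ^ 4 <= (K * r) ^ 4)
      by (split; [apply pow_le; lra|apply pow_incr; lra]).
    assert (0 <= amp Q r ^ 2) by (apply pow_le; lra).
    rewrite Rpow_mult_distr in *.
    assert (r ^ 4 <= r) by (replace (r ^ 4) with (r ^ 2 * r ^ 2) by ring; nra).
    assert (0 < K ^ 4) by (apply pow_lt; lra).
    assert (0 < K ^ 2) by (apply pow_lt; lra).
    assert (r ^ 2 * slope Q Q1 r ^ 2 <= r * K ^ 2)
      by (apply Rmult_le_compat; try lra; apply pow2_ge_0).
    assert (0 <= k * amp Q r ^ 4) by (apply Rmult_le_pos; lra).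
    assert (K ^ 4 * r ^ 4 <= K ^ 4 * r) by nra.
    lra. }
unfold F in HF; rewrite Hsp in HF.
unfold amp in HF.
assert (HE : p ^ 4 * Q p ^ 4 - 2 * p ^ 2 * Q p ^ 2 - p ^ 4 * Q p ^ 2 <= 0).
{ replace (p ^ 4 * Q p ^ 2) with (k * Q p ^ 2 * (p ^ 4 * Q p ^ 2))
    by (rewrite HkQ; ring).
  nra. }
assert (0 < p ^ 2) by (apply pow_lt; lra).
assert (0 < p ^ 2 * Q p ^ 2) by (apply Rmult_lt_0_compat; lra).
assert (p ^ 2 * Q p ^ 2 <= 2 + p ^ 2).
{ apply Rmult_le_reg_l with (p ^ 2 * Q p ^ 2); [assumption|].
  replace (p ^ 4) with (p ^ 2 * p ^ 2) in HE by ring.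
  replace (Q p ^ 4) with (Q p ^ 2 * Q p ^ 2) in HE by ring.
  lra. }
nra.
Qed.

(** At a critical point of u the positive energy reduces to Q^2 > 2; before it
    Q is larger still, so u is concave up to there and beyond, until Q drops
    to 1, after which [slope_neg_of_profile_le1] takes over. *)
Lemma amp_has_peak (Q Q1 : R -> R) :
  radial_profile Q Q1 ->
  exists p, 0 < p /\ p ^ 2 < 2 /\
    (forall r, 0 < r <= p -> 0 <= slope Q Q1 r) /\
    (forall r, p < r -> slope Q Q1 r < 0).
Proof.
intros HP; pose proof HP as (Hpos & _ & _ & Hlim & _).
destruct (Hlim 1 ltac:(lra)) as [b0 [Hb0 Hb]].
destruct (amp_slope_near_zero Q Q1 HP) as (c & K & d & Hc & HK & Hd & H0).
set (b := b0 + d).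
assert (Hsb : slope Q Q1 b < 0).
{ apply slope_neg_of_profile_le1; [exact HP|unfold b; lra|].
  specialize (Hb b ltac:(unfold b; lra)); lra. }
assert (Hsa : 0 < slope Q Q1 (d / 2)) by (destruct (H0 (d / 2) ltac:(lra)); lra).
destruct (IVT_interv (fun x => - slope Q Q1 x) (d / 2) b) as [p [Hp Hpz]].
- intros x Hx; apply continuity_pt_opp.
  apply (is_derive_continuity_pt _ _ _ (is_derive_slope Q Q1 x HP ltac:(lra))).
- unfold b; lra.
- lra.
- lra.
- assert (Hp0 : 0 < p) by lra.
  assert (Hsp : slope Q Q1 p = 0) by lra.
  assert (HQp : 2 < Q p ^ 2).
  { assert (HE := energy_pos Q Q1 p HP Hp0); rewrite energy_eq in HE by lra.
    rewrite Hsp in HE; assert (HA := amp_pos Q Q1 p HP Hp0).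
    assert (0 < amp Q p ^ 2) by now apply pow_lt.
    nra. }
  assert (HQp1 : 1 < Q p) by (specialize (Hpos p Hp0); nra).
  assert (Hconc : forall x, 0 < x -> 1 < Q x -> (1 - Q x ^ 2) * amp Q x < 0).
  { intros x Hx HQx; assert (HA := amp_pos Q Q1 x HP Hx).
    assert (1 - Q x ^ 2 < 0) by nra. nra. }
  assert (Hleft : forall r, 0 < r <= p -> 0 <= slope Q Q1 r).
  { intros r Hr; rewrite <- Hsp.
    apply (derive_nonpos_ge _ (fun r => (1 - Q r ^ 2) * amp Q r)); [lra|].
    intros x Hx; split; [apply is_derive_slope; [exact HP|lra]|].
    left; apply Hconc; [lra|].
    destruct (Req_dec x p) as [->|]; [lra|].
    assert (HL := profile_lt Q Q1 x p HP ltac:(lra)); lra. }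
  exists p; split; [exact Hp0|]; split; [now apply (peak_radius_sq_lt2 Q Q1)|].
  split; [exact Hleft|].
  intros r Hr.
  destruct (Rle_lt_dec (Q r) 1) as [HQr|HQr];
    [apply slope_neg_of_profile_le1; [exact HP|lra|exact HQr]|].
  rewrite <- Hsp.
  apply (derive_neg_gt _ (fun r => (1 - Q r ^ 2) * amp Q r)); [lra|].
  intros x Hx; split; [apply is_derive_slope; [exact HP|lra]|].
  apply Hconc; [lra|].
  destruct (Req_dec x r) as [->|]; [lra|].
  assert (HL := profile_lt Q Q1 x r HP ltac:(lra)); lra.
Qed.

(** * The logarithmic decay rate of u *)

(** Where Q <= 1, the energy is at most u'^2 / 2. If it stayed above e, the
    decreasing function u would become negative. *)
Lemma energy_vanishes (Q Q1 : R -> R) (p r0 e : R) :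
  radial_profile Q Q1 -> (forall r, p < r -> slope Q Q1 r < 0) ->
  0 < e -> 0 < r0 -> p < r0 ->
  exists r, r0 <= r /\ energy Q Q1 r < e.
Proof.
intros HP Hs He Hr0 Hpr.
pose proof HP as (Hpos & _ & _ & Hlim & _).
destruct (Hlim 1 ltac:(lra)) as [R0 [HR0 HR]].
set (c := Rmin 1 e).
assert (Hc : 0 < c /\ c <= 1 /\ c <= e).
{ unfold c; repeat split; [apply Rmin_pos; lra|apply Rmin_l|apply Rmin_r]. }
set (a := Rmax r0 R0).
assert (Ha : r0 <= a /\ R0 <= a) by (split; [apply Rmax_l|apply Rmax_r]).
(* On [a, s] the slope is at most - c, which makes u(s) <= - c. *)
set (s := a + amp Q a / c + 1).
assert (HAa := amp_pos Q Q1 a HP ltac:(lra)).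
assert (0 < amp Q a / c) by (apply Rdiv_lt_0_compat; lra).
assert (Has : a < s) by (unfold s; lra).
destruct (Rlt_le_dec (energy Q Q1 s) e) as [Hlt|Hge];
  [exists s; split; [lra|exact Hlt]|exfalso].
assert (Hsl : forall x, a <= x <= s -> slope Q Q1 x <= - c).
{ intros x Hx.
  assert (HEx : e <= energy Q Q1 x).
  { destruct (Req_dec x s) as [->|]; [lra|].
    assert (HL := energy_lt Q Q1 x s HP ltac:(lra)); lra. }
  rewrite energy_eq in HEx by lra.
  assert (HA := amp_pos Q Q1 x HP ltac:(lra)).
  assert (HQ := HR x ltac:(lra)); assert (HQ' := Hpos x ltac:(lra)).
  assert (0 <= amp Q x ^ 2 * (1 - Q x ^ 2 / 2))
    by (apply Rmult_le_pos; [apply pow2_ge_0|nra]).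
  specialize (Hs x ltac:(lra)); nra. }
assert (Hg : amp Q s + c * s <= amp Q a + c * a).
{ apply (derive_nonpos_ge (fun x => amp Q x + c * x)
          (fun x => slope Q Q1 x + c)); [lra|].
  intros x Hx; assert (HA := is_derive_amp Q Q1 x HP ltac:(lra)); split.
  - auto_derive; [repeat split; eexists; apply HA|].
    derive_val HA; ring.
  - specialize (Hsl x Hx); lra. }
assert (HAs := amp_pos Q Q1 s HP ltac:(lra)).
assert (c * (s - a) = amp Q a + c) by (unfold s; field; lra).
lra.
Qed.

(** Says that energy / u decreases, since energy' = - u^4 / (2 r^3). Put
    G = u^5 / (2 r^3 (- u')). Then G - energy is nonincreasing because
    u' < 0 and 4 u'^2 >= (1 - Q^2) u^2: the second is trivial for Q >= 1 and follows from
    positivity of the energy for Q < 1. As G > 0 and the energy tends to 0,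
    G - energy can never be negative. *)
Lemma energy_slope_bound (Q Q1 : R -> R) (p r : R) :
  radial_profile Q Q1 -> 0 < p -> (forall r, p < r -> slope Q Q1 r < 0) ->
  p < r ->
  energy Q Q1 r * - slope Q Q1 r <= amp Q r ^ 5 / (2 * r ^ 3).
Proof.
intros HP Hp Hs Hr.
set (G := fun r => amp Q r ^ 5 / (2 * r ^ 3 * - slope Q Q1 r)).
assert (HG : forall x, p < x -> 0 < G x).
{ intros x Hx; specialize (Hs x Hx).
  apply Rdiv_lt_0_compat; [apply pow_lt, (amp_pos Q Q1); [exact HP|lra]|].
  assert (0 < x ^ 3) by (apply pow_lt; lra); nra. }
assert (HGE : energy Q Q1 r <= G r).
{ destruct (Rle_lt_dec (energy Q Q1 r) (G r)) as [|Hlt]; [assumption|exfalso].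
  destruct (energy_vanishes Q Q1 p r (energy Q Q1 r - G r) HP Hs
    ltac:(lra) ltac:(lra) Hr) as [x [Hrx Hx]].
  cut (G x - energy Q Q1 x <= G r - energy Q Q1 r).
  { specialize (HG x ltac:(lra)); lra. }
  apply (derive_nonpos_ge (fun y => G y - energy Q Q1 y) (fun y =>
    amp Q y ^ 4 / (4 * y ^ 4 * slope Q Q1 y ^ 2) *
    (2 * (y * (- 4 * slope Q Q1 y ^ 2 + (1 - Q y ^ 2) * amp Q y ^ 2)
     + 3 * amp Q y * slope Q Q1 y)))); [lra|].
  intros y Hy; specialize (Hs y ltac:(lra)).
  assert (HA := amp_pos Q Q1 y HP ltac:(lra)).
  assert (H3 : 0 < y ^ 3) by (apply pow_lt; lra).
  split.
  - assert (HdA := is_derive_amp Q Q1 y HP ltac:(lra)).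
    assert (HdS := is_derive_slope Q Q1 y HP ltac:(lra)).
    assert (HdE := is_derive_energy Q Q1 y HP ltac:(lra)).
    unfold G; auto_derive.
    + repeat split; try (eexists; eassumption); nra.
    + derive_val HdA; derive_val HdS; derive_val HdE; field; split; lra.
  - assert (HE := energy_pos Q Q1 y HP ltac:(lra)).
    rewrite energy_eq in HE by lra.
    assert (Hc : - 4 * slope Q Q1 y ^ 2 + (1 - Q y ^ 2) * amp Q y ^ 2 <= 0).
    { pose proof (pow2_ge_0 (slope Q Q1 y)); pose proof (pow2_ge_0 (amp Q y)).
      destruct (Rle_lt_dec 1 (Q y ^ 2)); nra. }
    assert (0 < amp Q y ^ 4 / (4 * y ^ 4 * slope Q Q1 y ^ 2)).
    { apply Rdiv_lt_0_compat; [now apply pow_lt|].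
      assert (0 < y ^ 4) by (apply pow_lt; lra).
      assert (0 < slope Q Q1 y ^ 2) by nra. nra. }
    assert (amp Q y * slope Q Q1 y < 0) by nra.
    assert (y * (- 4 * slope Q Q1 y ^ 2 + (1 - Q y ^ 2) * amp Q y ^ 2) <= 0)
      by nra.
    rewrite <- (Rmult_0_r (amp Q y ^ 4 / (4 * y ^ 4 * slope Q Q1 y ^ 2))).
    apply Rmult_le_compat_l; lra. }
specialize (Hs r Hr).
apply Rmult_le_compat_r with (r := - slope Q Q1 r) in HGE; [|lra].
eapply Rle_trans; [exact HGE|]; right; unfold G; field; split; lra.
Qed.

(** The logarithmic decay rate Phi = - u' / u solves the Riccati equation
    Phi' = Q^2 - 1 + Phi^2. It is the comparison function beyond the maximum
    of u: it vanishes at that maximum and stays bounded at infinity, exactly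
    like the threshold resonance tanh of the potential - 2 sech^2 on the
    line, to which the picture degenerates for very wide Q. *)
Definition decay_rate (Q Q1 : R -> R) (r : R) : R := - slope Q Q1 r / amp Q r.

Definition decay_rate1 (Q Q1 : R -> R) (r : R) : R :=
  Q r ^ 2 - 1 + decay_rate Q Q1 r ^ 2.

Definition decay_rate2 (Q Q1 : R -> R) (r : R) : R :=
  2 * Q r * Q1 r + 2 * decay_rate Q Q1 r * decay_rate1 Q Q1 r.

Lemma is_derive_decay_rate (Q Q1 : R -> R) (r : R) :
  radial_profile Q Q1 -> 0 < r ->
  is_derive (decay_rate Q Q1) r (decay_rate1 Q Q1 r).
Proof.
intros HP Hr; unfold decay_rate1, decay_rate.
assert (HA := is_derive_amp Q Q1 r HP Hr).
assert (HS := is_derive_slope Q Q1 r HP Hr).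
assert (HA0 := amp_pos Q Q1 r HP Hr).
auto_derive.
- repeat split; try (eexists; eassumption); lra.
- derive_val HA; derive_val HS; field; lra.
Qed.

Lemma is_derive_decay_rate1 (Q Q1 : R -> R) (r : R) :
  radial_profile Q Q1 -> 0 < r ->
  is_derive (decay_rate1 Q Q1) r (decay_rate2 Q Q1 r).
Proof.
intros HP Hr; unfold decay_rate2.
assert (HD := is_derive_decay_rate Q Q1 r HP Hr).
assert (HQ := proj1 (proj2 HP) r Hr).
unfold decay_rate1 at 1; auto_derive.
- repeat split; eexists; eassumption.
- derive_val HD; derive_val HQ; ring.
Qed.

Lemma decay_rate_pos (Q Q1 : R -> R) (r : R) :
  radial_profile Q Q1 -> 0 < r -> slope Q Q1 r < 0 -> 0 < decay_rate Q Q1 r.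
Proof.
intros HP Hr Hs; apply Rdiv_lt_0_compat; [lra|now apply (amp_pos Q Q1)].
Qed.

(** The Riccati equation gives
    Phi'' + Q^2 Phi = 4 energy Phi / u^2 - 2 Q^2 / r, and
    [energy_slope_bound] makes the right-hand side nonpositive. *)
Lemma decay_rate_supersolution (Q Q1 : R -> R) (p r : R) :
  radial_profile Q Q1 -> 0 < p -> (forall r, p < r -> slope Q Q1 r < 0) ->
  p < r ->
  decay_rate2 Q Q1 r <= - Q r ^ 2 * decay_rate Q Q1 r.
Proof.
intros HP Hp Hs Hr.
assert (HES := energy_slope_bound Q Q1 p r HP Hp Hs Hr).
assert (HA := amp_pos Q Q1 r HP ltac:(lra)).
assert (HQ := proj1 HP r ltac:(lra)).
assert (Heq : decay_rate2 Q Q1 r + Q r ^ 2 * decay_rate Q Q1 r =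
  4 / amp Q r ^ 3 * (energy Q Q1 r * - slope Q Q1 r
    - amp Q r ^ 5 / (2 * r ^ 3))).
{ unfold decay_rate2, decay_rate1, decay_rate.
  rewrite energy_eq by lra.
  replace (Q1 r) with ((slope Q Q1 r - Q r) / r) by (unfold slope; field; lra).
  unfold amp; field; split; lra. }
assert (0 < 4 / amp Q r ^ 3) by (apply Rdiv_lt_0_compat; [lra|now apply pow_lt]).
nra.
Qed.

Lemma decay_rate_sq_ge_half (Q Q1 : R -> R) (r : R) :
  radial_profile Q Q1 -> 0 < r -> Q r <= 1 -> 1 / 2 <= decay_rate Q Q1 r ^ 2.
Proof.
intros HP Hr HQ1.
assert (HA := amp_pos Q Q1 r HP Hr); assert (HQ := proj1 HP r Hr).
assert (HE := energy_pos Q Q1 r HP Hr); rewrite energy_eq in HE by lra.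
assert (Hs : slope Q Q1 r ^ 2 = decay_rate Q Q1 r ^ 2 * amp Q r ^ 2)
  by (unfold decay_rate; field; lra).
rewrite Hs in HE.
apply Rmult_le_reg_r with (amp Q r ^ 2); [now apply pow_lt|].
assert (0 < amp Q r ^ 2) by now apply pow_lt.
assert (Q r ^ 2 <= 1) by nra.
nra.
Qed.

(** Phi is concave by [decay_rate_supersolution], so Phi' is bounded above, and
    Phi^2 = Phi' + 1 - Q^2. *)
Lemma decay_rate_sq_bounded (Q Q1 : R -> R) (p : R) :
  radial_profile Q Q1 -> 0 < p -> (forall r, p < r -> slope Q Q1 r < 0) ->
  exists B, 0 < B /\ forall r, p + 1 <= r -> decay_rate Q Q1 r ^ 2 <= B.
Proof.
intros HP Hp Hs.
exists (Rabs (decay_rate1 Q Q1 (p + 1)) + 1); split.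
- pose proof (Rabs_pos (decay_rate1 Q Q1 (p + 1))); lra.
- intros r Hr.
  assert (H : decay_rate1 Q Q1 r <= decay_rate1 Q Q1 (p + 1)).
  { apply (derive_nonpos_ge _ (decay_rate2 Q Q1)); [lra|].
    intros x Hx; split; [apply is_derive_decay_rate1; [exact HP|lra]|].
    assert (HL := decay_rate_supersolution Q Q1 p x HP Hp Hs ltac:(lra)).
    assert (HD := decay_rate_pos Q Q1 x HP ltac:(lra) (Hs x ltac:(lra))).
    pose proof (pow2_ge_0 (Q x)); nra. }
  unfold decay_rate1 at 1 in H.
  pose proof (pow2_ge_0 (Q r)); pose proof (Rle_abs (decay_rate1 Q Q1 (p + 1))).
  lra.
Qed.

(** * Picone comparison *)

Definition solution (q v v1 : R -> R) : Prop :=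
  forall r, 0 < r -> is_derive v r (v1 r) /\ is_derive v1 r (q r * v r).

Definition positive_supersolution_at (q w w1 w2 : R -> R) (r : R) : Prop :=
  is_derive w r (w1 r) /\ is_derive w1 r (w2 r) /\ 0 < w r /\
  w2 r <= q r * w r.

Definition wronskian (w w1 v v1 : R -> R) (r : R) : R :=
  w r * v1 r - w1 r * v r.

(** For h = v / w this is w^2 h h' = (w^2 / 2) (h^2)', Picone's quantity. *)
Definition picone (w w1 v v1 : R -> R) (r : R) : R :=
  v r * wronskian w w1 v v1 r / w r.

Lemma is_derive_picone (q w w1 w2 v v1 : R -> R) (r : R) :
  solution q v v1 -> 0 < r -> positive_supersolution_at q w w1 w2 r ->
  is_derive (picone w w1 v v1) r
    ((wronskian w w1 v v1 r / w r) ^ 2 + v r ^ 2 * (q r * w r - w2 r) / w r).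
Proof.
intros Hv Hr (Hw & Hw1 & Hpos & _); destruct (Hv r Hr) as [Hv0 Hv1].
unfold picone, wronskian; auto_derive.
- repeat split; try (eexists; eassumption); lra.
- derive_val Hw; derive_val Hw1; derive_val Hv0; derive_val Hv1; field; lra.
Qed.

Lemma picone_slope_ge (q w w1 w2 v v1 : R -> R) (r : R) :
  positive_supersolution_at q w w1 w2 r ->
  (wronskian w w1 v v1 r / w r) ^ 2 <=
  (wronskian w w1 v v1 r / w r) ^ 2 + v r ^ 2 * (q r * w r - w2 r) / w r.
Proof.
intros (_ & _ & Hpos & Hle).
assert (0 <= v r ^ 2 * (q r * w r - w2 r) / w r); [|lra].
apply Rmult_le_pos; [|left; now apply Rinv_0_lt_compat].
apply Rmult_le_pos; [apply pow2_ge_0|lra].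
Qed.

Lemma picone_le (q w w1 w2 v v1 : R -> R) (a b : R) :
  solution q v v1 -> 0 < a <= b ->
  (forall r, a <= r <= b -> positive_supersolution_at q w w1 w2 r) ->
  picone w w1 v v1 a <= picone w w1 v v1 b.
Proof.
intros Hv Hab Hw.
apply (derive_nonneg_le _ (fun r => (wronskian w w1 v v1 r / w r) ^ 2
  + v r ^ 2 * (q r * w r - w2 r) / w r)); [lra|].
intros x Hx; split; [apply is_derive_picone; [exact Hv|lra|now apply Hw]|].
eapply Rle_trans; [|apply picone_slope_ge; now apply Hw].
apply pow2_ge_0.
Qed.

Definition quotient (v w : R -> R) (r : R) : R := v r / w r.

Lemma is_derive_quotient (w w1 v v1 : R -> R) (r : R) :
  is_derive w r (w1 r) -> is_derive v r (v1 r) -> 0 < w r ->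
  is_derive (quotient v w) r (wronskian w w1 v v1 r / w r ^ 2).
Proof.
intros Hw Hv Hpos; unfold quotient, wronskian; auto_derive.
- repeat split; try (eexists; eassumption); lra.
- derive_val Hw; derive_val Hv; field; lra.
Qed.

(** Picone's quantity is nondecreasing against a positive supersolution, so it
    vanishes on the whole interval; then its derivative, which dominates
    (w h')^2, vanishes too, and h = v / w is constant. The zero of v makes
    this constant 0. *)
Lemma picone_rigid (q w w1 w2 v v1 : R -> R) (a b : R) :
  solution q v v1 -> 0 < a < b ->
  (forall r, a <= r <= b -> positive_supersolution_at q w w1 w2 r) ->
  0 <= picone w w1 v v1 a -> picone w w1 v v1 b <= 0 ->
  v a = 0 \/ v b = 0 ->
  exists x, 0 < x /\ v x = 0 /\ v1 x = 0.
Proof.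
intros Hv Hab Hw Ha Hb Hz.
assert (HJ : forall r, a <= r <= b -> picone w w1 v v1 r = 0).
{ intros r Hr; apply Rle_antisym.
  - eapply Rle_trans; [|exact Hb].
    apply (picone_le q w w1 w2); [exact Hv|lra|]; intros x Hx; apply Hw; lra.
  - eapply Rle_trans; [exact Ha|].
    apply (picone_le q w w1 w2); [exact Hv|lra|]; intros x Hx; apply Hw; lra. }
assert (HW : forall r, a < r < b -> wronskian w w1 v v1 r = 0).
{ intros r Hr.
  assert (Hwr := Hw r ltac:(lra)).
  assert (HD := is_derive_picone q w w1 w2 v v1 r Hv ltac:(lra) Hwr).
  assert (H0 : is_derive (picone w w1 v v1) r 0).
  { apply is_derive_ext_loc with (fun _ => 0); [|apply @is_derive_const].
    assert (He : 0 < Rmin (r - a) (b - r)) by (apply Rmin_pos; lra).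
    exists (mkposreal _ He); intros y Hy; symmetry; apply HJ.
    apply (Rabs_lt_between' y r) in Hy; simpl in Hy.
    pose proof (Rmin_l (r - a) (b - r)); pose proof (Rmin_r (r - a) (b - r)).
    lra. }
  assert (Hge := picone_slope_ge q w w1 w2 v v1 r Hwr).
  rewrite <- (is_derive_unique _ _ _ HD), (is_derive_unique _ _ _ H0) in Hge.
  destruct Hwr as (_ & _ & Hpos & _).
  assert (Hq : wronskian w w1 v v1 r / w r = 0) by nra.
  replace (wronskian w w1 v v1 r)
    with (wronskian w w1 v v1 r / w r * w r) by (field; lra).
  rewrite Hq; ring. }
assert (Hconst : forall x y, a <= x < y -> y <= b -> v y / w y = v x / w x).
{ intros x y Hx Hy.
  destruct (MVT_gen (quotient v w) x y (fun _ => 0)) as [c [_ Hc]].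
  - intros r Hr; rewrite Rmin_left, Rmax_right in Hr by lra.
    destruct (Hw r ltac:(lra)) as (Hw0 & _ & Hpos & _).
    replace 0 with (wronskian w w1 v v1 r / w r ^ 2)
      by (rewrite HW by lra; field; lra).
    apply is_derive_quotient; [exact Hw0|apply Hv; lra|exact Hpos].
  - intros r Hr; rewrite Rmin_left, Rmax_right in Hr by lra.
    destruct (Hw r ltac:(lra)) as (Hw0 & _ & Hpos & _).
    eapply is_derive_continuity_pt, is_derive_quotient;
      [exact Hw0|apply (Hv r ltac:(lra))|exact Hpos].
  - unfold quotient in Hc; lra. }
set (m := (a + b) / 2).
assert (Hm : a < m < b) by (unfold m; lra).
destruct (Hw m ltac:(lra)) as (_ & _ & Hpos & _).
assert (Hvm : v m = 0).
{ replace (v m) with (v m / w m * w m) by (field; lra).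
  destruct Hz as [Hz|Hz].
  - rewrite (Hconst a m), Hz by lra.
    destruct (Hw a ltac:(lra)) as (_ & _ & Hposa & _); field; lra.
  - rewrite <- (Hconst m b), Hz by lra.
    destruct (Hw b ltac:(lra)) as (_ & _ & Hposb & _); field; lra. }
exists m; split; [lra|]; split; [exact Hvm|].
specialize (HW m Hm); unfold wronskian in HW; rewrite Hvm in HW; nra.
Qed.

(** Uniqueness for the Cauchy problem by a Gronwall estimate for
    v^2 + v'^2. *)
Lemma solution_zero_data (q v v1 : R -> R) (K x : R) :
  solution q v v1 -> (forall r, 0 < r -> Rabs (q r) <= K) ->
  0 < x -> v x = 0 -> v1 x = 0 -> forall r, 0 < r -> v r = 0.
Proof.
intros Hv HK Hx Hvx Hv1x r Hr.
set (D := fun s => v s ^ 2 + v1 s ^ 2).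
set (D1 := fun s => 2 * v s * v1 s * (1 + q s)).
assert (HD : forall s, 0 < s -> is_derive D s (D1 s)).
{ intros s Hs; destruct (Hv s Hs) as [H0 H1]; unfold D, D1; auto_derive.
  - repeat split; eexists; eassumption.
  - derive_val H0; derive_val H1; ring. }
set (L := 1 + K).
assert (HD1 : forall s, 0 < s -> - L * D s <= D1 s <= L * D s).
{ intros s Hs; specialize (HK s Hs); apply Rabs_le_between in HK.
  unfold D, D1, L.
  pose proof (pow2_ge_0 (v s + v1 s)); pose proof (pow2_ge_0 (v s - v1 s)).
  assert (- (v s ^ 2 + v1 s ^ 2) <= 2 * v s * v1 s <= v s ^ 2 + v1 s ^ 2) by nra.
  assert (- (1 + K) <= 1 + q s <= 1 + K) by lra.
  split; nra. }
assert (Hexp : forall k s, 0 < s ->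
  is_derive (fun s => D s * exp (k * s)) s ((D1 s + k * D s) * exp (k * s))).
{ intros k s Hs; assert (H := HD s Hs); auto_derive; [eexists; exact H|].
  derive_val H; ring. }
assert (HDx : D x = 0) by (unfold D; rewrite Hvx, Hv1x; ring).
assert (HDr : D r <= 0).
{ destruct (Rle_lt_dec x r) as [Hxr|Hxr].
  - apply Rmult_le_reg_r with (exp (- L * r)); [apply exp_pos|].
    rewrite Rmult_0_l; replace 0 with (D x * exp (- L * x))
      by (rewrite HDx; ring).
    apply (derive_nonpos_ge (fun s => D s * exp (- L * s))
      (fun s => (D1 s + - L * D s) * exp (- L * s))); [lra|].
    intros s Hs; split; [apply Hexp; lra|].
    destruct (HD1 s ltac:(lra)); pose proof (exp_pos (- L * s)); nra.
  - apply Rmult_le_reg_r with (exp (L * r)); [apply exp_pos|].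
    rewrite Rmult_0_l; replace 0 with (D x * exp (L * x))
      by (rewrite HDx; ring).
    apply (derive_nonneg_le (fun s => D s * exp (L * s))
      (fun s => (D1 s + L * D s) * exp (L * s))); [lra|].
    intros s Hs; split; [apply Hexp; lra|].
    destruct (HD1 s ltac:(lra)); pose proof (exp_pos (L * s)); nra. }
unfold D in HDr; pose proof (pow2_ge_0 (v r)); pose proof (pow2_ge_0 (v1 r)).
nra.
Qed.

(** * Zeros of solutions *)

Definition regular_at_zero (v v1 : R -> R) : Prop :=
  exists C d, 0 < C /\ 0 < d /\
    forall r, 0 < r < d -> Rabs (v r) <= C * r /\ Rabs (v1 r) <= C.

Definition potential (Q : R -> R) (lambda r : R) : R := 1 - lambda - Q r ^ 2.

(** For w = (1 - r^2 / 2) u one finds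
    w'' - (1 - lambda - Q^2) w = - u - 2 r u' + lambda (1 - r^2 / 2) u, which
    is nonpositive for lambda <= 1 as long as u' >= 0 and r^2 < 2. *)
Lemma inner_supersolution (Q Q1 : R -> R) (lambda p r : R) :
  radial_profile Q Q1 -> lambda <= 1 -> p ^ 2 < 2 ->
  (forall r, 0 < r <= p -> 0 <= slope Q Q1 r) -> 0 < r <= p ->
  positive_supersolution_at (potential Q lambda)
    (fun r => (1 - r ^ 2 / 2) * amp Q r)
    (fun r => - r * amp Q r + (1 - r ^ 2 / 2) * slope Q Q1 r)
    (fun r => - amp Q r - 2 * r * slope Q Q1 r
       + (1 - r ^ 2 / 2) * ((1 - Q r ^ 2) * amp Q r)) r.
Proof.
intros HP Hl Hp2 Hs Hr.
assert (HA := is_derive_amp Q Q1 r HP ltac:(lra)).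
assert (HS := is_derive_slope Q Q1 r HP ltac:(lra)).
assert (HA0 := amp_pos Q Q1 r HP ltac:(lra)).
assert (Hr2 : 0 < r ^ 2 < 2) by (split; [apply pow_lt; lra|nra]).
specialize (Hs r Hr).
split; [|split; [|split]].
- auto_derive; [eexists; exact HA|]; derive_val HA; field.
- auto_derive; [repeat split; eexists; eassumption|].
  derive_val HA; derive_val HS; field.
- apply Rmult_lt_0_compat; lra.
- unfold potential.
  assert (0 <= r * slope Q Q1 r) by nra.
  assert (0 < (1 - r ^ 2 / 2) * amp Q r) by (apply Rmult_lt_0_compat; lra).
  assert (0 < r ^ 2 * amp Q r) by (apply Rmult_lt_0_compat; lra).
  nra.
Qed.

(** Picone's quantity for the inner supersolution tends to 0 at the origin and
    vanishes at a zero of v. *)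
Lemma zero_before_peak (Q Q1 v v1 : R -> R) (lambda p a : R) :
  radial_profile Q Q1 -> lambda <= 1 -> p ^ 2 < 2 ->
  (forall r, 0 < r <= p -> 0 <= slope Q Q1 r) ->
  solution (potential Q lambda) v v1 -> regular_at_zero v v1 ->
  0 < a <= p -> v a = 0 ->
  exists x, 0 < x /\ v x = 0 /\ v1 x = 0.
Proof.
intros HP Hl Hp2 Hs Hv (C & d & HC & Hd & H0) Ha Hva.
set (w := fun r => (1 - r ^ 2 / 2) * amp Q r).
set (w1 := fun r => - r * amp Q r + (1 - r ^ 2 / 2) * slope Q Q1 r).
set (w2 := fun r => - amp Q r - 2 * r * slope Q Q1 r
       + (1 - r ^ 2 / 2) * ((1 - Q r ^ 2) * amp Q r)).
assert (Hw : forall r, 0 < r <= p ->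
  positive_supersolution_at (potential Q lambda) w w1 w2 r).
{ intros r Hr; now apply (inner_supersolution Q Q1 lambda p r). }
apply (picone_rigid (potential Q lambda) w w1 w2 v v1 (a / 2) a);
  [exact Hv|lra|intros r Hr; apply Hw; lra| | |now right].
- destruct (amp_slope_near_zero Q Q1 HP) as (c & K & e & Hc & HK & He & HAS).
  cut (- picone w w1 v v1 (a / 2) <= 0); [lra|].
  apply (nonpos_from_zero (fun r => - picone w w1 v v1 r) (fun r =>
     - ((wronskian w w1 v v1 r / w r) ^ 2
        + v r ^ 2 * (potential Q lambda r * w r - w2 r) / w r))
     (C ^ 2 + C ^ 2 * (4 * K / c)) (Rmin d e)); [apply Rmin_pos; lra|lra| |].
  + intros r Hr; split.
    * apply is_derive_opp_val, is_derive_picone; [exact Hv|lra|apply Hw; lra].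
    * assert (HL := picone_slope_ge _ w w1 w2 v v1 r (Hw r ltac:(lra))).
      pose proof (pow2_ge_0 (wronskian w w1 v v1 r / w r)); lra.
  + intros r [Hr0 Hr]; pose proof (Rmin_l d e); pose proof (Rmin_r d e).
    destruct (H0 r ltac:(lra)) as [Hb Hb1].
    destruct (HAS r ltac:(lra)) as [HA HS].
    assert (Hr2 : 0 < r ^ 2 < 1) by (split; [apply pow_lt; lra|nra]).
    assert (Hcr : 0 < c * r) by nra.
    assert (Hwr : c * r / 2 <= w r) by (unfold w; nra).
    assert (Hw1r : w1 r <= K).
    { unfold w1. assert (0 < r * amp Q r) by nra. nra. }
    replace (- picone w w1 v v1 r)
      with (- (v r * v1 r) + v r ^ 2 * w1 r / w r)
      by (unfold picone, wronskian; field; lra).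
    assert (Hvv : - (v r * v1 r) <= C ^ 2 * r).
    { apply Rabs_le_between in Hb; apply Rabs_le_between in Hb1; nra. }
    assert (Hv2 : 0 <= v r ^ 2 <= C ^ 2 * r ^ 2).
    { split; [apply pow2_ge_0|].
      rewrite <- Rpow_mult_distr, <- (pow2_abs (v r)).
      apply pow_incr; split; [apply Rabs_pos|exact Hb]. }
    assert (Hq : v r ^ 2 * w1 r / w r <= C ^ 2 * (4 * K / c) * r).
    { apply Rmult_le_reg_r with (w r); [lra|].
      replace (v r ^ 2 * w1 r / w r * w r) with (v r ^ 2 * w1 r)
        by (field; lra).
      apply Rle_trans with (v r ^ 2 * K); [apply Rmult_le_compat_l; lra|].
      apply Rle_trans with (C ^ 2 * r ^ 2 * K);
        [apply Rmult_le_compat_r; lra|].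
      apply Rle_trans with (C ^ 2 * (4 * K / c) * r * (c * r / 2)).
      - replace (C ^ 2 * (4 * K / c) * r * (c * r / 2))
          with (2 * (C ^ 2 * r ^ 2 * K)) by (field; lra).
        assert (0 < C ^ 2 * r ^ 2 * K)
          by (repeat apply Rmult_lt_0_compat; try apply pow_lt; lra).
        lra.
      - apply Rmult_le_compat_l; [|exact Hwr].
        assert (0 < 4 * K / c) by (apply Rdiv_lt_0_compat; lra).
        apply Rmult_le_pos; [apply Rmult_le_pos; [apply pow2_ge_0|]|]; lra. }
    lra.
- right; unfold picone; rewrite Hva; unfold Rdiv; ring.
Qed.

Definition bounded_at_infinity (v : R -> R) : Prop :=
  exists C R0, forall r, R0 <= r -> Rabs (v r) <= C.

(** If Picone's quantity became positive after the zero a, then (v / Phi)^2,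
    whose derivative is twice that quantity divided by Phi^2, would grow at
    least linearly because Phi is bounded. But Phi is also bounded below, so
    v would be unbounded. *)
Lemma zero_after_peak (Q Q1 v v1 : R -> R) (lambda p a : R) :
  radial_profile Q Q1 -> lambda <= 1 -> 0 < p ->
  (forall r, p < r -> slope Q Q1 r < 0) ->
  solution (potential Q lambda) v v1 -> bounded_at_infinity v ->
  p < a -> v a = 0 ->
  exists x, 0 < x /\ v x = 0 /\ v1 x = 0.
Proof.
intros HP Hl Hp Hs Hv (C & R0 & HC) Ha Hva.
set (w := decay_rate Q Q1); set (w1 := decay_rate1 Q Q1).
set (w2 := decay_rate2 Q Q1).
assert (Hw : forall r, p < r ->
  positive_supersolution_at (potential Q lambda) w w1 w2 r).
{ intros r Hr; split; [apply is_derive_decay_rate; [exact HP|lra]|].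
  split; [apply is_derive_decay_rate1; [exact HP|lra]|].
  assert (Hpos := decay_rate_pos Q Q1 r HP ltac:(lra) (Hs r Hr)).
  split; [exact Hpos|].
  assert (HL := decay_rate_supersolution Q Q1 p r HP Hp Hs Hr).
  unfold potential; fold w in Hpos, HL |- *; fold w2 in HL; nra. }
assert (HJa : picone w w1 v v1 a = 0)
  by (unfold picone; rewrite Hva; unfold Rdiv; ring).
apply (picone_rigid (potential Q lambda) w w1 w2 v v1 a (a + 1));
  [exact Hv|lra|intros r Hr; apply Hw; lra|lra| |now left].
set (b := a + 1); set (j := picone w w1 v v1 b).
destruct (Rle_lt_dec j 0) as [|Hj]; [assumption|exfalso].
destruct (decay_rate_sq_bounded Q Q1 p HP Hp Hs) as [B [HB0 HB]]; fold w in HB.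
pose proof HP as (Hpos & _ & _ & Hlim & _).
destruct (Hlim 1 ltac:(lra)) as [R1 [HR1 HQ1]].
set (k := 2 * j / B).
assert (Hk : 0 < k) by (apply Rdiv_lt_0_compat; lra).
(* At s, growth at rate k gives (v / Phi)^2 >= 2 C^2 + 1, while Phi^2 >= 1/2
   and v^2 <= C^2. *)
set (s := Rmax (Rmax R0 R1) (b + (2 * C ^ 2 + 1) / k)).
assert (Hs' : R0 <= s /\ R1 <= s /\ b + (2 * C ^ 2 + 1) / k <= s).
{ unfold s; repeat split.
  - eapply Rle_trans; [apply Rmax_l|apply Rmax_l].
  - eapply Rle_trans; [apply Rmax_r|apply Rmax_l].
  - apply Rmax_r. }
assert (0 < (2 * C ^ 2 + 1) / k).
{ apply Rdiv_lt_0_compat; [pose proof (pow2_ge_0 C); lra|exact Hk]. }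
assert (Hba : b = a + 1) by reflexivity.
assert (Hgrow : (v b / w b) ^ 2 - k * b <= (v s / w s) ^ 2 - k * s).
{ apply (derive_nonneg_le (fun r => quotient v w r ^ 2 - k * r)
    (fun r => 2 * picone w w1 v v1 r / w r ^ 2 - k)); [lra|].
  intros r Hr; destruct (Hw r ltac:(lra)) as (Hw0 & _ & Hwp & _).
  destruct (Hv r ltac:(lra)) as [Hv0 _].
  split.
  - assert (HD := is_derive_quotient w w1 v v1 r Hw0 Hv0 Hwp).
    auto_derive; [eexists; exact HD|]; derive_val HD.
    unfold quotient, picone; field; lra.
  - assert (HJ : j <= picone w w1 v v1 r).
    { apply (picone_le (potential Q lambda) w w1 w2); [exact Hv|lra|].
      intros x Hx; apply Hw; lra. }
    specialize (HB r ltac:(lra)).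
    assert (Hw2 : 0 < w r ^ 2) by now apply pow_lt.
    cut (k <= 2 * picone w w1 v v1 r / w r ^ 2); [lra|].
    apply Rle_trans with (2 * j / w r ^ 2).
    + unfold k; apply Rmult_le_compat_l; [lra|now apply Rinv_le_contravar].
    + apply Rmult_le_compat_r; [left; now apply Rinv_0_lt_compat|lra]. }
assert (Hks : 2 * C ^ 2 + 1 <= k * (s - b)).
{ replace (2 * C ^ 2 + 1) with (k * ((2 * C ^ 2 + 1) / k)) by (field; lra).
  apply Rmult_le_compat_l; lra. }
pose proof (pow2_ge_0 (v b / w b)).
assert (Hhalf : 1 / 2 <= w s ^ 2).
{ apply decay_rate_sq_ge_half; [exact HP|lra|].
  specialize (HQ1 s ltac:(lra)); lra. }
assert (Hvs : v s ^ 2 <= C ^ 2).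
{ rewrite <- (pow2_abs (v s)); apply pow_incr; split; [apply Rabs_pos|].
  apply HC; lra. }
assert (Heq : v s ^ 2 = (v s / w s) ^ 2 * w s ^ 2).
{ destruct (Hw s ltac:(lra)) as (_ & _ & Hwp & _); field; lra. }
nra.
Qed.

(** Both u and v solve their equations without zeros, for the spectral
    parameters 0 and lambda > 0. Their Wronskian starts at 0 and has derivative
    - lambda u v < 0, so (v / u)' stays below a negative constant once u
    decreases, and v / u must change sign. *)
Lemma solution_not_positive (Q Q1 v v1 : R -> R) (lambda p : R) :
  radial_profile Q Q1 -> 0 < lambda -> 0 < p ->
  (forall r, p < r -> slope Q Q1 r < 0) ->
  solution (potential Q lambda) v v1 -> regular_at_zero v v1 ->
  ~ (forall r, 0 < r -> 0 < v r).
Proof.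
intros HP Hl Hp Hs Hv (C & d & HC & Hd & H0) Hpos.
set (W := wronskian (amp Q) (slope Q Q1) v v1).
assert (HW : forall r, 0 < r -> is_derive W r (- lambda * amp Q r * v r)).
{ intros r Hr; destruct (Hv r Hr) as [Hv0 Hv1].
  assert (HA := is_derive_amp Q Q1 r HP Hr).
  assert (HS := is_derive_slope Q Q1 r HP Hr).
  unfold W, wronskian; auto_derive.
  - repeat split; eexists; eassumption.
  - derive_val HA; derive_val HS; derive_val Hv0; derive_val Hv1.
    unfold potential; ring. }
assert (HW' : forall r, 0 < r -> - lambda * amp Q r * v r < 0).
{ intros r Hr; assert (HA := amp_pos Q Q1 r HP Hr); specialize (Hpos r Hr).
  assert (0 < amp Q r * v r) by (apply Rmult_lt_0_compat; lra); nra. }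
set (a := p + 1).
assert (Ha : 0 < a) by (unfold a; lra).
assert (HWa : W a < 0).
{ destruct (amp_slope_near_zero Q Q1 HP) as (c & K & e & Hc & HK & He & HAS).
  apply (neg_from_zero W (fun r => - lambda * amp Q r * v r) (2 * K * C)
    (Rmin d e)); [apply Rmin_pos; lra|lra| |].
  - intros r Hr; split; [apply HW; lra|apply HW'; lra].
  - intros r [Hr0 Hr]; pose proof (Rmin_l d e); pose proof (Rmin_r d e).
    destruct (H0 r ltac:(lra)) as [Hb Hb1].
    destruct (HAS r ltac:(lra)) as [HA HS].
    apply Rabs_le_between in Hb; apply Rabs_le_between in Hb1.
    specialize (Hpos r Hr0).
    assert (0 < c * r) by nra.
    assert (amp Q r * v1 r <= K * r * C) by nra.
    assert (0 <= slope Q Q1 r * v r) by nra.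
    unfold W, wronskian; nra. }
assert (HAa := amp_pos Q Q1 a HP Ha).
set (k := - W a / amp Q a ^ 2).
assert (Hk : 0 < k) by (apply Rdiv_lt_0_compat; [lra|now apply pow_lt]).
(* The point where a decrease of v / u at rate k has used up its value. *)
set (s := a + v a / amp Q a / k).
assert (Hva := Hpos a Ha).
assert (Hq : 0 < v a / amp Q a / k)
  by (apply Rdiv_lt_0_compat; [now apply Rdiv_lt_0_compat|exact Hk]).
assert (Has : a < s) by (unfold s; lra).
assert (Hdec : v s / amp Q s + k * s <= v a / amp Q a + k * a).
{ apply (derive_nonpos_ge (fun r => quotient v (amp Q) r + k * r)
    (fun r => W r / amp Q r ^ 2 + k)); [lra|].
  intros r Hr; destruct (Hv r ltac:(lra)) as [Hv0 _].
  assert (HA := is_derive_amp Q Q1 r HP ltac:(lra)).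
  assert (HAp := amp_pos Q Q1 r HP ltac:(lra)).
  split.
  - assert (HD := is_derive_quotient _ _ _ _ r HA Hv0 HAp).
    auto_derive; [eexists; exact HD|]; derive_val HD; unfold W; ring.
  - assert (HWr : W r <= W a).
    { apply (derive_nonpos_ge W (fun r => - lambda * amp Q r * v r)); [lra|].
      intros x Hx; split; [apply HW; lra|left; apply HW'; lra]. }
    assert (HAr : amp Q r <= amp Q a).
    { apply (derive_nonpos_ge _ (slope Q Q1)); [lra|].
      intros x Hx; split; [apply is_derive_amp; [exact HP|lra]|].
      left; apply Hs; unfold a in Hx; lra. }
    cut (k <= - W r / amp Q r ^ 2); [unfold Rdiv; lra|].
    unfold k; apply Rmult_le_compat; [lra| |lra|].
    + left; apply Rinv_0_lt_compat; now apply pow_lt.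
    + apply Rinv_le_contravar; [now apply pow_lt|apply pow_incr; lra]. }
assert (Hks : k * (s - a) = v a / amp Q a) by (unfold s; field; lra).
assert (Hvs := Hpos s ltac:(lra)).
assert (0 < v s / amp Q s)
  by (apply Rdiv_lt_0_compat; [exact Hvs|apply (amp_pos Q Q1); [exact HP|lra]]).
lra.
Qed.

Lemma positive_of_no_zero (v v1 : R -> R) :
  (forall r, 0 < r -> is_derive v r (v1 r)) ->
  (forall r, 0 < r -> v r <> 0) -> 0 < v 1 -> forall r, 0 < r -> 0 < v r.
Proof.
intros Hd Hz H1 r Hr.
destruct (Rlt_le_dec 0 (v r)) as [|Hle]; [assumption|exfalso].
assert (Hneg : v r < 0) by (specialize (Hz r Hr); lra).
assert (Hc : forall x, 0 < x -> continuity_pt v x).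
{ intros x Hx; exact (is_derive_continuity_pt _ _ _ (Hd x Hx)). }
destruct (Rtotal_order r 1) as [Hr1|[->|Hr1]]; [|lra|].
- destruct (IVT_interv v r 1) as [z [Hz1 Hz2]]; try lra.
  + intros x Hx; apply Hc; lra.
  + apply (Hz z); [lra|exact Hz2].
- destruct (IVT_interv (fun x => - v x) 1 r) as [z [Hz1 Hz2]]; try lra.
  + intros x Hx; apply continuity_pt_opp, Hc; lra.
  + apply (Hz z); lra.
Qed.

(** A zero of v on either side of the maximum of u forces zero Cauchy data
    somewhere; absence of zeros is excluded by [solution_not_positive], applied
    to v or to - v. *)
Lemma bounded_regular_solution_zero (Q Q1 v v1 : R -> R) (lambda : R) :
  radial_profile Q Q1 -> 0 < lambda <= 1 ->
  solution (potential Q lambda) v v1 -> regular_at_zero v v1 ->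
  bounded_at_infinity v -> forall r, 0 < r -> v r = 0.
Proof.
intros HP Hl Hv H0 Hinf.
destruct (amp_has_peak Q Q1 HP) as (p & Hp & Hp2 & Hsl & Hsr).
assert (Hzero : (exists a, 0 < a /\ v a = 0) -> forall r, 0 < r -> v r = 0).
{ intros [a [Ha Hva]].
  assert (Hx : exists x, 0 < x /\ v x = 0 /\ v1 x = 0).
  { destruct (Rle_lt_dec a p) as [Hap|Hap].
    - apply (zero_before_peak Q Q1 v v1 lambda p a); try assumption; lra.
    - apply (zero_after_peak Q Q1 v v1 lambda p a); try assumption; lra. }
  destruct Hx as (x & Hx & Hvx & Hv1x).
  destruct (profile_bounded Q Q1 HP) as [B [HB HQB]].
  apply (solution_zero_data (potential Q lambda) v v1 (1 + B ^ 2) x);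
    try assumption.
  intros r Hr; specialize (HQB r Hr); assert (HQ := proj1 HP r Hr).
  assert (0 <= Q r ^ 2 <= B ^ 2)
    by (split; [apply pow2_ge_0|apply pow_incr; lra]).
  unfold potential; apply Rabs_le; lra. }
intros r Hr.
destruct (Req_dec (v r) 0) as [|Hne]; [assumption|exfalso].
assert (Hnz : forall s, 0 < s -> v s <> 0).
{ intros s Hs Hvs; apply Hne, Hzero; [now exists s|exact Hr]. }
destruct (Rtotal_order (v 1) 0) as [H1|[H1|H1]].
- apply (solution_not_positive Q Q1 (fun r => - v r) (fun r => - v1 r) lambda p);
    try assumption; [lra| | |].
  + intros s Hs; destruct (Hv s Hs) as [Ha Hb].
    split; [now apply is_derive_opp_val|].
    replace (potential Q lambda s * - v s) with (- (potential Q lambda s * v s))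
      by ring.
    now apply is_derive_opp_val.
  + destruct H0 as (C & d & HC & Hd & H0); exists C, d.
    split; [exact HC|]; split; [exact Hd|]; intros s Hs.
    rewrite !Rabs_Ropp; now apply H0.
  + apply (positive_of_no_zero _ (fun r => - v1 r)); [| |lra].
    * intros s Hs; apply is_derive_opp_val, (Hv s Hs).
    * intros s Hs; specialize (Hnz s Hs); lra.
- now apply (Hnz 1 Rlt_0_1).
- apply (solution_not_positive Q Q1 v v1 lambda p); try assumption; [lra|].
  apply (positive_of_no_zero v v1); [|exact Hnz|exact H1].
  intros s Hs; apply (Hv s Hs).
Qed.

(** * From eigenfunctions to solutions *)

Lemma radial_solution (Q y : R -> R) (lambda : R) :
  twice_derivable_pos y ->
  (forall r, 0 < r -> Lminus Q y r = lambda * y r) ->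
  solution (potential Q lambda) (fun r => r * y r)
    (fun r => y r + r * Derive y r).
Proof.
intros Hy Heq r Hr; destruct (Hy r Hr) as [Hd Hd1].
assert (HL := Heq r Hr); unfold Lminus in HL.
change (Derive_n y 2 r) with (Derive (Derive y) r) in HL.
split.
- auto_derive; [exact Hd|change (fun x => y x) with y; ring].
- auto_derive; [repeat split; assumption|].
  change (fun x => y x) with y; change (fun x => Derive y x) with (Derive y).
  replace (Derive (Derive y) r) with
    ((1 - Q r ^ 2) * y r - lambda * y r - 2 / r * Derive y r) by lra.
  unfold potential; field; lra.
Qed.

(** v'' is bounded near the origin because v and Q are, so v' is Lipschitz
    there. *)
Lemma bounded_solution_regular (Q Q1 v v1 : R -> R) (lambda M d : R) :
  radial_profile Q Q1 -> 0 < lambda <= 1 ->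
  solution (potential Q lambda) v v1 -> 0 < d ->
  (forall r, 0 < r < d -> Rabs (v r) <= M * r) ->
  regular_at_zero v v1.
Proof.
intros HP Hl Hv Hd HM.
destruct (profile_bounded Q Q1 HP) as [B [HB HQB]].
set (e := d / 2).
assert (HM0 : 0 <= M).
{ assert (HMe := HM e ltac:(unfold e; lra)); pose proof (Rabs_pos (v e)).
  unfold e in *; nra. }
set (L := (1 + B ^ 2) * (M * d)).
assert (HB2 : 0 < B ^ 2) by now apply pow_lt.
assert (HL : 0 <= L) by (unfold L; apply Rmult_le_pos; nra).
assert (Hbnd : forall r, 0 < r < d -> - L <= potential Q lambda r * v r <= L).
{ intros r Hr; apply Rabs_le_between; rewrite Rabs_mult; unfold L.
  apply Rmult_le_compat; try apply Rabs_pos.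
  - specialize (HQB r ltac:(lra)); assert (HQ := proj1 HP r ltac:(lra)).
    assert (0 <= Q r ^ 2 <= B ^ 2)
      by (split; [apply pow2_ge_0|apply pow_incr; lra]).
    unfold potential; apply Rabs_le; lra.
  - eapply Rle_trans; [now apply HM|nra]. }
exists (M + Rabs (v1 e) + L * d + 1), e.
pose proof (Rabs_pos (v1 e)).
assert (0 <= L * d) by nra.
split; [lra|]; split; [unfold e; lra|]; intros r Hr; unfold e in Hr.
split.
- eapply Rle_trans; [apply HM; lra|]; nra.
- assert (Hlip : forall k, (forall r, 0 < r < d -> 0 <= potential Q lambda r * v r + k) ->
     v1 r + k * r <= v1 e + k * e).
  { intros k Hk.
    apply (derive_nonneg_le (fun x => v1 x + k * x)
      (fun x => potential Q lambda x * v x + k)); [unfold e; lra|].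
    intros x Hx; unfold e in Hx; destruct (Hv x ltac:(lra)) as [_ H1].
    split; [|apply Hk; lra].
    auto_derive; [eexists; exact H1|]; derive_val H1; ring. }
  assert (Hlip' : v1 e - L * e <= v1 r - L * r).
  { apply (derive_nonpos_ge (fun x => v1 x - L * x)
      (fun x => potential Q lambda x * v x - L)); [unfold e; lra|].
    intros x Hx; unfold e in Hx; destruct (Hv x ltac:(lra)) as [_ H1].
    split; [|specialize (Hbnd x ltac:(lra)); lra].
    auto_derive; [eexists; exact H1|]; derive_val H1; ring. }
  assert (Hup := Hlip L ltac:(intros x Hx; specialize (Hbnd x Hx); lra)).
  pose proof (Rle_abs (v1 e)); pose proof (Rle_abs (- v1 e)) as Hn.
  rewrite Rabs_Ropp in Hn.
  assert (0 <= L * r) by nra.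
  assert (L * e <= L * d) by (unfold e; nra).
  apply Rabs_le; lra.
Qed.

Theorem theorem5p1 (Q : R -> R) (hQ : ground_state Q) (lambda : R)
  (hlambda : 0 < lambda <= 1) :
  ~ eigenvalue_or_resonance Q lambda.
Proof.
intros (y & Hy & Heq & [r0 [Hr0 Hyr0]] & [M HM] & [C HC]).
assert (HP := ground_state_profile Q hQ).
assert (Hsol := radial_solution Q y lambda Hy Heq).
cut (r0 * y r0 = 0); [intros H; destruct (Rmult_integral _ _ H); lra|].
apply (bounded_regular_solution_zero Q (Derive Q) (fun r => r * y r)
  (fun r => y r + r * Derive y r) lambda); try assumption.
- destruct HM as [d Hd].
  apply (bounded_solution_regular Q (Derive Q) _ _ lambda M d); try assumption.
  + apply cond_pos.
  + intros r Hr; rewrite Rabs_mult, (Rabs_pos_eq r), Rmult_comm by lra.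
    apply Rmult_le_compat_r; [lra|]; apply Hd; [|lra].
    apply (Rabs_lt_between' r 0); lra.
- destruct HC as [R0 HR0].
  exists (Rabs C), (Rmax R0 0 + 1); intros r Hr.
  pose proof (Rmax_l R0 0); pose proof (Rmax_r R0 0).
  specialize (HR0 r ltac:(lra)).
  rewrite Rabs_mult, (Rabs_pos_eq r) by lra.
  assert (Hexp : 0 < exp (- r * sqrt (1 - lambda)) <= 1).
  { split; [apply exp_pos|].
    assert (Hle : - r * sqrt (1 - lambda) <= 0)
      by (pose proof (sqrt_pos (1 - lambda)); nra).
    destruct Hle as [Hlt|He]; [|rewrite He, exp_0; lra].
    apply exp_increasing in Hlt; rewrite exp_0 in Hlt; lra. }
  apply Rle_trans with (r * (C * (/ r * exp (- r * sqrt (1 - lambda)))));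
    [apply Rmult_le_compat_l; lra|].
  replace (r * (C * (/ r * exp (- r * sqrt (1 - lambda)))))
    with (C * exp (- r * sqrt (1 - lambda))) by (field; lra).
  pose proof (Rle_abs C); pose proof (Rabs_pos C); nra.
Qed.
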